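(* Let $V$, $V'$, $W$ be transitive models of ${\rm Z}^*+{\rm DC}_\delta$, where $\delta$ is a regular cardinal of $W$. Suppose that the pairs $V\subseteq W$ and $V'\subseteq W$ both have the $\delta$-cover and $\delta$-approximation properties, that $P(\delta)^V=P(\delta)^{V'}$, and that $H^W\cap V=H^V$, where for a model $M$, $H^M$ denotes the collection in $M$ of all sets of hereditary size at most $\delta$. Then $V=V'$.
   Context: ${\rm Z}^*$ is Zermelo set theory (without choice) together with the axiom asserting that the universe is the union of the von Neumann hierarchy $V_\alpha$. ${\rm DC}_\delta$: for any nonempty set $S$ and binary relation $R$, if for every $s\in S^{<\delta}$ there is $y\in S$ with $s\,R\,y$, then there is $f:\delta\to S$ with $(f\upharpoonright\alpha)\,R\,f(\alpha)$ for all $\alpha<\delta$. For transitive models $V\subseteq W$ and a cardinal $\delta$ of $W$: the pair has the $\delta$-cover property if for every $A\in W$ with $A\subseteq V$ and $|A|^W<\delta$ there is $B\in V$ with $A\subseteq B$ and $|B|^V<\delta$; it has the $\delta$-approximation property if whenever $A\in W$, $A\subseteq V$, and $A\cap a\in V$ for every $a\in V$ of size less than $\delta$ in $V$, then $A\in V$. *)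

(* Defs.v *)
(** Transitive models of set theory, as subclasses of an ambient universe.

    Every set-theoretic notion below takes a class [M] and is the
    relativization of the usual first-order definition to [M]: all its
    quantifiers range over [M].  Thus [is_cardinal M x] reads "M satisfies: x is
    a cardinal", and so on. *)

(** By the Mostowski collapse, an extensional well-founded structure is, up to
    isomorphism, a transitive class with the true membership relation.  No
    further axioms are imposed on the ambient universe, so the models considered
    may be sets or proper classes, and need not be definable. *)
Record set_universe : Type := SetUniverse {
  carrier :> Type;
  mem : carrier -> carrier -> Prop;
  mem_ext : forall x y, (forall z, mem z x <-> mem z y) -> x = y;
  mem_wf : well_founded mem
}.

Arguments mem {_} _ _.

Notation "x ∈ y" := (mem x y) (at level 70, no associativity).
Notation "∀[ M ] x , P" := (forall x, M x -> P)
  (at level 200, x name, P at level 200).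
Notation "∃[ M ] x , P" := (exists x, M x /\ P)
  (at level 200, x name, P at level 200).

Definition class (U : set_universe) : Type := U -> Prop.

Definition subclass {U} (M N : class U) : Prop := forall x, M x -> N x.

Definition transitive_class {U} (M : class U) : Prop :=
  forall x y, M y -> x ∈ y -> M x.

(** Formulas of the language of set theory, with de Bruijn indices. *)
Inductive formula : Type :=
| FMem (i j : nat)
| FEq (i j : nat)
| FNot (p : formula)
| FAnd (p q : formula)
| FOr (p q : formula)
| FImp (p q : formula)
| FAll (p : formula)
| FEx (p : formula).

Definition env_cons {U : set_universe} (x : U) (e : nat -> U) : nat -> U :=
  fun n => match n with O => x | S k => e k end.

Fixpoint sat {U} (M : class U) (p : formula) (e : nat -> U) : Prop :=
  match p with
  | FMem i j => e i ∈ e j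
  | FEq i j => e i = e j
  | FNot p => ~ sat M p e
  | FAnd p q => sat M p e /\ sat M q e
  | FOr p q => sat M p e \/ sat M q e
  | FImp p q => sat M p e -> sat M q e
  | FAll p => ∀[M] x, sat M p (env_cons x e)
  | FEx p => ∃[M] x, sat M p (env_cons x e)
  end.

Section Relativized.

Context {U : set_universe} (M : class U).

Definition subset (a b : U) : Prop := ∀[M] z, (z ∈ a -> z ∈ b).

Definition is_empty (a : U) : Prop := ∀[M] z, ~ z ∈ a.

Definition is_upair (a b p : U) : Prop := ∀[M] z, (z ∈ p <-> z = a \/ z = b).

Definition is_union (a u : U) : Prop :=
  ∀[M] z, (z ∈ u <-> ∃[M] y, (y ∈ a /\ z ∈ y)).

Definition is_powerset (a p : U) : Prop := ∀[M] z, (z ∈ p <-> subset z a).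

(** [s] is [a ∪ {a}]. *)
Definition is_succ (a s : U) : Prop := ∀[M] z, (z ∈ s <-> z ∈ a \/ z = a).

(** Kuratowski pairs: [p] is [{{a}, {a, b}}]. *)
Definition is_opair (a b p : U) : Prop :=
  ∃[M] u, ∃[M] v, (is_upair a a u /\ is_upair a b v /\ is_upair u v p).

(** The pair [(a, b)] belongs to [r]; for a function [r], the value at [a] is [b]. *)
Definition related (r a b : U) : Prop := ∃[M] p, (is_opair a b p /\ p ∈ r).

Definition is_function (f d : U) : Prop :=
  (∀[M] p, (p ∈ f -> ∃[M] x, ∃[M] y, (x ∈ d /\ is_opair x y p))) /\
  (∀[M] x, (x ∈ d -> ∃[M] y, related f x y)) /\
  (∀[M] x, ∀[M] y, ∀[M] y', (related f x y -> related f x y' -> y = y')).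

Definition is_function_to (f d c : U) : Prop :=
  is_function f d /\ ∀[M] x, ∀[M] y, (related f x y -> y ∈ c).

Definition is_bijection (f d c : U) : Prop :=
  is_function_to f d c /\
  (∀[M] x, ∀[M] x', ∀[M] y, (related f x y -> related f x' y -> x = x')) /\
  (∀[M] y, (y ∈ c -> ∃[M] x, related f x y)).

Definition is_restriction (f a g : U) : Prop :=
  ∀[M] p, (p ∈ g <-> p ∈ f /\ ∃[M] x, ∃[M] y, (x ∈ a /\ is_opair x y p)).

Definition transitive_set (a : U) : Prop := ∀[M] x, (x ∈ a -> subset x a).

Definition is_ordinal (a : U) : Prop :=
  transitive_set a /\
  (∀[M] x, ∀[M] y, (x ∈ a -> y ∈ a -> x ∈ y \/ x = y \/ y ∈ x)) /\
  (∀[M] s, (subset s a -> (∃[M] x, x ∈ s) ->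
     ∃[M] m, (m ∈ s /\ ∀[M] x, (x ∈ s -> ~ x ∈ m)))).

(** The first infinite ordinal: a limit all of whose elements are zero or
    successors. *)
Definition is_omega (w : U) : Prop :=
  is_ordinal w /\
  (∃[M] x, x ∈ w) /\
  (∀[M] x, (x ∈ w -> ∃[M] s, (is_succ x s /\ s ∈ w))) /\
  (∀[M] n, (n ∈ w -> is_empty n \/ ∃[M] m, is_succ m n)).

Definition equinumerous (a b : U) : Prop := ∃[M] f, is_bijection f a b.

(** [k = |a|]; in the absence of choice, [a] need not have such a [k]. *)
Definition is_cardinality (a k : U) : Prop :=
  is_ordinal k /\ equinumerous a k /\ ∀[M] b, (b ∈ k -> ~ equinumerous a b).

Definition size_lt (a d : U) : Prop := ∃[M] k, (is_cardinality a k /\ k ∈ d).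

Definition size_le (a d : U) : Prop :=
  ∃[M] k, (is_cardinality a k /\ (k ∈ d \/ k = d)).

Definition is_cardinal (d : U) : Prop :=
  is_ordinal d /\ ∀[M] b, (b ∈ d -> ~ equinumerous d b).

Definition infinite_ordinal (d : U) : Prop :=
  is_ordinal d /\ ∃[M] w, (is_omega w /\ (w ∈ d \/ w = d)).

Definition regular_cardinal (d : U) : Prop :=
  M d /\ is_cardinal d /\ infinite_ordinal d /\
  ∀[M] b, (b ∈ d -> ∀[M] f, (is_function_to f b d ->
    ∃[M] c, (c ∈ d /\ ∀[M] x, ∀[M] y, (related f x y -> y ∈ c \/ y = c)))).

Definition is_transitive_closure (x t : U) : Prop :=
  transitive_set t /\ subset x t /\
  ∀[M] s, (transitive_set s -> subset x s -> subset t s).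

(** This collection need not be a set in [M]. *)
Definition hereditary_le (d : U) : class U :=
  fun x => M x /\ ∃[M] t, (is_transitive_closure x t /\ size_le t d).

Definition power_class (d : U) : class U := fun x => M x /\ subset x d.

(** [f] satisfies the recursion [V_b = ⋃_{c < b} P(V_c)] on the ordinal [d]. *)
Definition is_hierarchy (f d : U) : Prop :=
  is_function f d /\
  ∀[M] b, ∀[M] v, (related f b v ->
    ∀[M] z, (z ∈ v <->
      ∃[M] c, (c ∈ b /\ ∃[M] u, (related f c u /\ subset z u)))).

Definition is_level (a v : U) : Prop :=
  is_ordinal a /\
  ∃[M] s, (is_succ a s /\ ∃[M] f, (is_hierarchy f s /\ related f a v)).

Definition ax_extensionality : Prop :=
  ∀[M] x, ∀[M] y, ((∀[M] z, (z ∈ x <-> z ∈ y)) -> x = y).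

Definition ax_foundation : Prop :=
  ∀[M] x, ((∃[M] y, y ∈ x) ->
    ∃[M] y, (y ∈ x /\ ∀[M] z, (z ∈ x -> ~ z ∈ y))).

Definition ax_pairing : Prop := ∀[M] a, ∀[M] b, ∃[M] p, is_upair a b p.

Definition ax_union : Prop := ∀[M] a, ∃[M] u, is_union a u.

Definition ax_powerset : Prop := ∀[M] a, ∃[M] p, is_powerset a p.

Definition ax_infinity : Prop :=
  ∃[M] w, ((∃[M] e, (is_empty e /\ e ∈ w)) /\
           ∀[M] x, (x ∈ w -> ∃[M] s, (is_succ x s /\ s ∈ w))).

(** Index 0 is the element being tested; [e] supplies the parameters. *)
Definition ax_separation : Prop :=
  forall (p : formula) (e : nat -> U), (forall n, M (e n)) ->
    ∀[M] a, ∃[M] b, ∀[M] x, (x ∈ b <-> x ∈ a /\ sat M p (env_cons x e)).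

Definition ax_hierarchy : Prop :=
  ∀[M] x, ∃[M] a, ∃[M] v, (is_level a v /\ x ∈ v).

Definition zermelo_star : Prop :=
  ax_extensionality /\ ax_foundation /\ ax_pairing /\ ax_union /\
  ax_powerset /\ ax_infinity /\ ax_separation /\ ax_hierarchy.

Definition dependent_choice (d : U) : Prop :=
  ∀[M] S, ∀[M] R,
    ((∃[M] y, y ∈ S) ->
     (∀[M] s, ((∃[M] a, (a ∈ d /\ is_function_to s a S)) ->
        ∃[M] y, (y ∈ S /\ related R s y))) ->
     ∃[M] f, (is_function_to f d S /\
       ∀[M] a, (a ∈ d ->
         ∃[M] r, ∃[M] y,
           (is_restriction f a r /\ related f a y /\ related R r y)))).

(** As [d] is a parameter of the theory [Z* + DC_d], it must belong to [M]. *)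
Definition transitive_model (d : U) : Prop :=
  transitive_class M /\ M d /\ zermelo_star /\ dependent_choice d.

End Relativized.

Definition cover_property {U} (V W : class U) (d : U) : Prop :=
  forall A, W A -> (forall z, z ∈ A -> V z) -> size_lt W A d ->
    exists B, V B /\ (forall z, z ∈ A -> z ∈ B) /\ size_lt V B d.

Definition approximation_property {U} (V W : class U) (d : U) : Prop :=
  forall A, W A -> (forall z, z ∈ A -> V z) ->
    (forall a, V a -> size_lt V a d ->
       exists c, V c /\ forall z, z ∈ c <-> z ∈ A /\ z ∈ a) ->
    V A.

(* Main.v *)
From Stdlib Require Import Classical ClassicalEpsilon.
Require Import Defs.

(** By induction on [b], the levels [V_b] of the two inner models agree; write [T] for such a common
    level. By approximation, it suffices that every small [a ⊆ T] lies in some [B ∈ V ∩ V'] all of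
    whose subsets are the same in [V] and [V'].

    Using [DC_δ] in [W], build a chain of length [δ] of small subsets of [T] above [a], covering each
    stage by a small member of [V] and a small member of [V'] inside the next stage, and separating
    the elements of each stage in the next. As [δ] is regular, small subsets of the union [B] are
    contained in a stage, so [B] belongs to both models by approximation. The structure [(B, ∈)] is
    extensional, so in [V] it has a transitive collapse, which has size at most [δ] in [W] and hence,
    by the hypothesis on [H], in [V]. Thus [V] has an injection of [B] into [δ]; the structure it
    induces on [δ] is coded by a subset of [δ], which lies in [V'], and there the injection is
    recovered as the unique isomorphism. Subsets of [B] now amount to subsets of [δ].

    Replacement is not available: recursively defined functions are obtained by separation, as unions
    of bisimulations inside a given product. Regularity of [δ] makes Gödel's pairing function map
    [δ × δ] into [δ], without induction on cardinals. *)

(** Pairs, ordinals, ranks, collapses and the pairing function are defined in the ambient universe,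
    with no model as parameter ([op], [ord], [rank_lt], [collapses], [paired]). They therefore mean
    the same in V, V' and W, and what is proved for each model is that it contains the graph in
    question. Size is measured by [embeds], which passes to larger models, and regularity by
    [regular_in], which passes to smaller ones, so facts move along the inclusions without comparing
    cardinals of different models.

    A chain of bare small sets would leave the size of its union open, as no enumerations of the
    stages come with it. The chain therefore consists of enumerations; dependent choice picks these,
    and the union embeds explicitly into δ × δ.

    Extensionality of (B, ∈) serves twice: it makes the collapse injective, and it makes the
    isomorphism with the structure coded on δ unique, so that V' finds it without knowing the map in
    V. The hypothesis on H concerns V alone; the other direction of the transfer starts from the
    embedding that V' has obtained in this way. *)

Definition look {U : set_universe} (e : nat -> U) (i : nat) (a : U) : Prop := e i = a.

(** Separation takes syntactic formulas, while the proofs state properties as propositions. [reif]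
    links the two; the tactic [reify] finds [p] from [P]. *)
Definition reif {U : set_universe} (M : class U) (e : nat -> U) (p : formula) (P : Prop) : Prop :=
  sat M p e <-> P.

Definition env_in {U : set_universe} (M : class U) (e : nat -> U) : Prop := forall n, M (e n).

Definition zmodel {U : set_universe} (M : class U) : Prop := transitive_class M /\ zermelo_star M.

(** The alternatives say z = {a} and z = {a, b}, with quantifiers over the whole universe, so that
    the pair does not depend on a model. *)
Definition opair_spec {U : set_universe} (a b p : U) : Prop :=
  forall z, z ∈ p <-> (forall w, w ∈ z <-> w = a) \/ (forall w, w ∈ z <-> w = a \/ w = b).

(** A junk value when [U] does not contain the Kuratowski pair of [a] and [b]. *)
Definition op {U : set_universe} (a b : U) : U := epsilon (inhabits a) (opair_spec a b).

Definition FIff (p q : formula) : formula := FAnd (FImp p q) (FImp q p).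

Definition FPair (i j k : nat) : formula :=
  FAll (FIff (FMem 0 (S k))
    (FOr (FAll (FIff (FMem 0 1) (FEq 0 (S (S i)))))
         (FAll (FIff (FMem 0 1) (FOr (FEq 0 (S (S i))) (FEq 0 (S (S j)))))))).

(** * Ordered pairs and separation *)

Section Basics.

Context {U : set_universe}.
Implicit Types (M : class U) (a b c d x y z r s t u v w : U).

Lemma mem_asym x y : x ∈ y -> ~ y ∈ x.
Proof.
  revert y; induction x as [x IH] using (well_founded_ind (mem_wf U)).
  intros y xy yx. exact (IH y yx x yx xy).
Qed.

Lemma mem_irrefl x : ~ x ∈ x.
Proof. intro h; exact (mem_asym x x h h). Qed.

Lemma trans_in M x y : zmodel M -> x ∈ y -> M y -> M x.
Proof. intros [h _] k l; exact (h x y l k). Qed.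

Lemma upair_in M a b : zmodel M -> M a -> M b ->
  exists u, M u /\ forall z, z ∈ u <-> z = a \/ z = b.
Proof.
  intros [tr (_ & _ & hp & _)] Ma Mb. destruct (hp a Ma b Mb) as [u [Mu hu]].
  exists u; split; auto. intro z; split; intro h.
  - apply hu; auto; eapply tr; eauto.
  - apply hu; auto; destruct h; subst; auto.
Qed.

Lemma opair_exists M a b : zmodel M -> M a -> M b -> exists p, M p /\ opair_spec a b p.
Proof.
  intros mM Ma Mb.
  destruct (upair_in M a a mM Ma Ma) as [u [Mu hu]].
  destruct (upair_in M a b mM Ma Mb) as [v [Mv hv]].
  destruct (upair_in M u v mM Mu Mv) as [p [Mp hp]].
  exists p; split; auto. intro z; rewrite hp; split.
  - intros [-> | ->]; [left | right; auto]. intro w; rewrite hu; tauto.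
  - intros [h | h]; [left | right]; apply mem_ext; intro w; rewrite h; [rewrite hu | rewrite hv]; tauto.
Qed.

Lemma op_spec M a b : zmodel M -> M a -> M b -> opair_spec a b (op a b).
Proof.
  intros mM Ma Mb. unfold op; apply epsilon_spec.
  destruct (opair_exists M a b mM Ma Mb) as [p [_ hp]]; eauto.
Qed.

Lemma opair_unique a b p q : opair_spec a b p -> opair_spec a b q -> p = q.
Proof. intros hp hq; apply mem_ext; intro z; rewrite (hp z), (hq z); tauto. Qed.

Lemma op_in M a b : zmodel M -> M a -> M b -> M (op a b).
Proof.
  intros mM Ma Mb. destruct (opair_exists M a b mM Ma Mb) as [p [Mp hp]].
  rewrite (opair_unique a b (op a b) p); auto. eapply op_spec; eauto.
Qed.

Lemma op_inj M a b c d : zmodel M -> M a -> M b -> M c -> M d -> op a b = op c d -> a = c /\ b = d.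
Proof.
  intros mM Ma Mb Mc Md h.
  assert (h1 := op_spec M a b mM Ma Mb). assert (h2 := op_spec M c d mM Mc Md).
  rewrite <- h in h2.
  destruct (upair_in M a a mM Ma Ma) as [u [_ hu]].
  destruct (upair_in M a b mM Ma Mb) as [v [_ hv]].
  destruct (upair_in M c d mM Mc Md) as [v' [_ hv']].
  assert (iu : u ∈ op a b) by (apply h1; left; intro w; rewrite hu; tauto).
  assert (iv : v ∈ op a b) by (apply h1; right; auto).
  assert (iv' : v' ∈ op a b) by (apply h2; right; auto).
  assert (ac : a = c).
  { apply h2 in iu. destruct iu as [k | k]; specialize (k c); rewrite hu in k; destruct k as [_ k];
      destruct k; auto. }
  subst c. split; auto.
  assert (kb : b = a \/ b = d).
  { assert (bv : b ∈ v) by (apply hv; auto).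
    apply h2 in iv. destruct iv as [k | k]; apply k in bv; tauto. }
  assert (kd : d = a \/ d = b).
  { assert (dv : d ∈ v') by (apply hv'; auto).
    apply h1 in iv'. destruct iv' as [k | k]; apply k in dv; tauto. }
  destruct kb, kd; subst; auto.
Qed.

(** By transitivity the quantifiers may be restricted to [M]; the result is what [FPair]
    expresses. *)
Lemma op_eq_iff M a b p : zmodel M -> M a -> M b -> M p ->
  (p = op a b <->
   forall z, M z -> (z ∈ p <-> (forall w, M w -> (w ∈ z <-> w = a)) \/
                               (forall w, M w -> (w ∈ z <-> w = a \/ w = b)))).
Proof.
  intros mM Ma Mb Mp.
  assert (bd : forall z P, (forall w, P w -> M w) -> M z ->
            ((forall w, M w -> (w ∈ z <-> P w)) <-> (forall w, w ∈ z <-> P w))).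
  { intros z P hP Mz; split; intros h w; auto. split; intro k.
    - apply h; auto. eapply trans_in; eauto.
    - apply h; auto. }
  assert (h1 := op_spec M a b mM Ma Mb).
  split.
  - intros -> z Mz. rewrite (h1 z).
    rewrite <- (bd z (fun w => w = a)), <- (bd z (fun w => w = a \/ w = b)); auto.
    + tauto.
    + intros w [-> | ->]; auto.
    + intros w ->; auto.
  - intro h. apply (opair_unique a b); auto. intro z. split; intro k.
    + assert (Mz : M z) by (eapply trans_in; eauto).
      apply h in k; auto.
      rewrite <- (bd z (fun w => w = a)), <- (bd z (fun w => w = a \/ w = b)); auto.
      * intros w [-> | ->]; auto.
      * intros w ->; auto.
    + assert (k' := proj2 (h1 z) k).
      assert (Mz : M z) by (eapply trans_in; [auto | eauto | apply op_in; auto]).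
      apply h; auto. destruct k as [k | k]; [left | right]; intros; apply k.
Qed.

Lemma opair_abs M a b p : zmodel M -> M a -> M b -> M p -> (is_opair M a b p <-> p = op a b).
Proof.
  intros mM Ma Mb Mp. split.
  - intros [u [Mu [v [Mv (hu & hv & hp)]]]]. apply (op_eq_iff M); auto. intros z Mz. rewrite (hp z Mz).
    split.
    + intros [-> | ->]; [left | right; exact hv]. intros w Mw; rewrite (hu w Mw); tauto.
    + intros [h | h]; [left | right]; apply mem_ext; intro w; split; intro k.
      all: assert (Mw : M w) by (eapply trans_in; eauto).
      * apply hu; auto; left; apply h; auto.
      * apply h; auto. apply hu in k; tauto.
      * apply hv; auto. apply h; auto.
      * apply h; auto. apply hv in k; auto.
  - intros ->.
    destruct (upair_in M a a mM Ma Ma) as [u [Mu hu]].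
    destruct (upair_in M a b mM Ma Mb) as [v [Mv hv]].
    exists u; split; auto. exists v; split; auto. split; [|split].
    + intros z _; apply hu.
    + intros z _; apply hv.
    + intros z Mz. rewrite (op_spec M a b mM Ma Mb z). split.
      * intros [h | h]; [left | right]; apply mem_ext; intro w; rewrite h; [rewrite hu | rewrite hv]; tauto.
      * intros [-> | ->]; [left | right; auto]. intro w; rewrite hu; tauto.
Qed.

Lemma related_abs M r a b : zmodel M -> M r -> M a -> M b -> (related M r a b <-> op a b ∈ r).
Proof.
  intros mM Mr Ma Mb. split.
  - intros [p [Mp [h k]]]. apply opair_abs in h; auto. subst; auto.
  - intro h. exists (op a b). assert (k : M (op a b)) by (apply op_in; auto).
    split; [auto | split; [apply opair_abs; auto | auto]].
Qed.

Lemma look0 a (e : nat -> U) : look (env_cons a e) 0 a.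
Proof. reflexivity. Qed.

Lemma lookS a b (e : nat -> U) i : look e i a -> look (env_cons b e) (S i) a.
Proof. auto. Qed.

Lemma env_in_cons M a (e : nat -> U) : M a -> env_in M e -> env_in M (env_cons a e).
Proof. intros h k [|n]; simpl; auto. Qed.

Lemma env_in_const M a : M a -> env_in M (fun _ => a).
Proof. intros h n; auto. Qed.

(** * Formulas that express given properties *)

Section Reif.

Context (M : class U) (e : nat -> U).
Implicit Types (p q : formula) (P Q : Prop).

Lemma reif_mem i j a b : look e i a -> look e j b -> reif M e (FMem i j) (a ∈ b).
Proof. unfold look; intros <- <-; unfold reif; simpl; tauto. Qed.

Lemma reif_eq i j a b : look e i a -> look e j b -> reif M e (FEq i j) (a = b).
Proof. unfold look; intros <- <-; unfold reif; simpl; tauto. Qed.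

Lemma reif_not p P : reif M e p P -> reif M e (FNot p) (~ P).
Proof. unfold reif; simpl; tauto. Qed.

Lemma reif_and p q P Q : reif M e p P -> reif M e q Q -> reif M e (FAnd p q) (P /\ Q).
Proof. unfold reif; simpl; tauto. Qed.

Lemma reif_or p q P Q : reif M e p P -> reif M e q Q -> reif M e (FOr p q) (P \/ Q).
Proof. unfold reif; simpl; tauto. Qed.

Lemma reif_imp p q P Q : reif M e p P -> reif M e q Q -> reif M e (FImp p q) (P -> Q).
Proof. unfold reif; simpl; tauto. Qed.

Lemma reif_iff p q P Q : reif M e p P -> reif M e q Q -> reif M e (FIff p q) (P <-> Q).
Proof. unfold reif; simpl; tauto. Qed.

Lemma reif_ex p (P : U -> Prop) : (forall x, M x -> reif M (env_cons x e) p (P x)) ->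
  reif M e (FEx p) (exists x, M x /\ P x).
Proof.
  unfold reif; simpl; intro h. split; intros [x [k l]]; exists x; split; auto; apply h; auto.
Qed.

Lemma reif_all p (P : U -> Prop) : (forall x, M x -> reif M (env_cons x e) p (P x)) ->
  reif M e (FAll p) (forall x, M x -> P x).
Proof. unfold reif; simpl; intro h. split; intros k x l; apply h; auto. Qed.

Lemma reif_ex_in j p a (P : U -> Prop) : zmodel M -> M a -> look e j a ->
  (forall x, M x -> reif M (env_cons x e) p (P x)) ->
  reif M e (FEx (FAnd (FMem 0 (S j)) p)) (exists x, x ∈ a /\ P x).
Proof.
  unfold reif, look; simpl; intros mM Ma <- h. split.
  - intros [x [k [l m]]]; exists x; split; auto; apply h; auto.
  - intros [x [k l]]. assert (Mx : M x) by (eapply trans_in; eauto).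
    exists x; split; auto; split; auto; apply h; auto.
Qed.

Lemma reif_all_in j p a (P : U -> Prop) : zmodel M -> M a -> look e j a ->
  (forall x, M x -> reif M (env_cons x e) p (P x)) ->
  reif M e (FAll (FImp (FMem 0 (S j)) p)) (forall x, x ∈ a -> P x).
Proof.
  unfold reif, look; simpl; intros mM Ma <- h. split.
  - intros k x l. assert (Mx : M x) by (eapply trans_in; eauto). apply h; auto.
  - intros k x Mx l; apply h; auto.
Qed.

Lemma reif_pair i j k a b (p : U) : zmodel M -> M a -> M b -> M p ->
  look e i a -> look e j b -> look e k p -> reif M e (FPair i j k) (p = op a b).
Proof.
  unfold look; intros mM Ma Mb Mp <- <- <-.
  unfold reif. rewrite (op_eq_iff M); auto. simpl.
  split; intros h z Mz; specialize (h z Mz); tauto.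
Qed.

(** The language has no terms: a pair inside an atomic formula becomes an existentially quantified
    variable. *)
Lemma reif_op1 p a b r : zmodel M -> M a -> M b ->
  reif M e p (exists x, M x /\ (x = op a b /\ x ∈ r)) -> reif M e p (op a b ∈ r).
Proof.
  unfold reif; intros mM Ma Mb ->. split.
  - intros [x [_ [-> h]]]; auto.
  - intro h; exists (op a b); split; [apply op_in; auto | auto].
Qed.

Lemma reif_op2 p a b c r : zmodel M -> M a -> M b ->
  reif M e p (exists x, M x /\ (x = op a b /\ op x c ∈ r)) -> reif M e p (op (op a b) c ∈ r).
Proof.
  unfold reif; intros mM Ma Mb ->. split.
  - intros [x [_ [-> h]]]; auto.
  - intro h; exists (op a b); split; [apply op_in; auto | auto].
Qed.

End Reif.

Lemma separation M (p : formula) (e : nat -> U) a (P : U -> Prop) : zmodel M ->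
  (forall x, M x -> reif M (env_cons x e) p (P x)) -> M a -> env_in M e ->
  exists b, M b /\ forall x, x ∈ b <-> x ∈ a /\ P x.
Proof.
  intros mM h Ma he. destruct (mM) as [tr (_ & _ & _ & _ & _ & _ & hs & _)].
  destruct (hs p e he a Ma) as [b [Mb hb]]. exists b; split; auto.
  intro x. split.
  - intro k. assert (Mx : M x) by (eapply trans_in; eauto).
    apply hb in k; auto. split; try tauto. apply h; tauto.
  - intros [k l]. assert (Mx : M x) by (eapply trans_in; eauto).
    apply hb; auto. split; auto. apply h; auto.
Qed.

End Basics.

(** Goals [look e ?i a]: when [a] does not occur in [e], it is a parameter, and is appended by
    instantiating the tail of [e], which is an existential variable until [env_tac] closes it. *)
Ltac look_tac := first [ simple apply look0 | simple apply lookS; look_tac ].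

Ltac reify :=
  lazymatch goal with
  | |- reif _ _ _ (_ /\ _) => apply reif_and; reify
  | |- reif _ _ _ (_ \/ _) => apply reif_or; reify
  | |- reif _ _ _ (_ <-> _) => apply reif_iff; reify
  | |- reif _ _ _ (~ _) => apply reif_not; reify
  | |- reif _ _ _ (op (op _ _) _ ∈ _) => eapply reif_op2; [assumption | assumption | assumption | reify]
  | |- reif _ _ _ (op _ _ ∈ _) => eapply reif_op1; [assumption | assumption | assumption | reify]
  | |- reif _ _ _ (_ ∈ _) => eapply reif_mem; look_tac
  | |- reif _ _ _ (_ = op _ _) =>
      eapply reif_pair; [assumption | assumption | assumption | assumption | look_tac | look_tac | look_tac]
  | |- reif _ _ _ (_ = _) => eapply reif_eq; look_tac
  | |- reif ?M _ _ (exists x, ?M x /\ _) => apply reif_ex; intros; reify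
  | |- reif _ _ _ (exists x, x ∈ _ /\ _) =>
      eapply reif_ex_in; [assumption | assumption | look_tac | intros; reify]
  | |- reif ?M _ _ (forall x, ?M x -> _) => apply reif_all; intros; reify
  | |- reif _ _ _ (forall x, x ∈ _ -> _) =>
      eapply reif_all_in; [assumption | assumption | look_tac | intros; reify]
  | |- reif _ _ _ (_ -> _) => apply reif_imp; reify
  end.

Ltac env_tac :=
  first [ apply env_in_cons; [assumption | env_tac] | eapply env_in_const; eassumption ].

Ltac sep := eapply separation; [assumption | intros; reify | assumption | env_tac].

(** * Unions, power sets, products and definable relations *)

Section Sets.

Context {U : set_universe}.
Implicit Types (M : class U) (a b c d x y z r s t u v w : U).

Lemma union_in M a : zmodel M -> M a ->
  exists u, M u /\ forall z, z ∈ u <-> exists y, y ∈ a /\ z ∈ y.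
Proof.
  intros mM Ma. destruct (mM) as [tr (_ & _ & _ & hu & _)].
  destruct (hu a Ma) as [u [Mu h]]. exists u; split; auto. intro z; split.
  - intro k. apply h in k; [|eapply trans_in; eauto]. destruct k as [y [_ k]]; eauto.
  - intros [y [k l]]. assert (My : M y) by (eapply trans_in; eauto).
    apply h; [eapply trans_in; eauto | eauto].
Qed.

Lemma power_in M a : zmodel M -> M a ->
  exists p, M p /\ forall z, z ∈ p <-> M z /\ forall w, w ∈ z -> w ∈ a.
Proof.
  intros mM Ma. destruct (mM) as [tr (_ & _ & _ & _ & hp & _)].
  destruct (hp a Ma) as [p [Mp h]]. exists p; split; auto. intro z; split.
  - intro k. assert (Mz : M z) by (eapply trans_in; eauto). split; auto.
    intros w l. apply (proj1 (h z Mz) k w); auto. eapply trans_in; eauto.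
  - intros [Mz k]. apply h; auto. intros w _; auto.
Qed.

Lemma product_in M a b : zmodel M -> M a -> M b ->
  exists p, M p /\ forall z, z ∈ p <-> exists x, x ∈ a /\ exists y, y ∈ b /\ z = op x y.
Proof.
  intros mM Ma Mb.
  destruct (upair_in M a b mM Ma Mb) as [c [Mc hc]].
  destruct (union_in M c mM Mc) as [u [Mu hu]].
  (* Here u = a ∪ b, and a Kuratowski pair of elements of u lies in P(P(u)). *)
  destruct (power_in M u mM Mu) as [v [Mv hv]].
  destruct (power_in M v mM Mv) as [w [Mw hw]].
  assert (h : exists p, M p /\ forall z, z ∈ p <-> z ∈ w /\ exists x, x ∈ a /\ exists y, y ∈ b /\ z = op x y)
    by sep.
  destruct h as [p [Mp hp]]. exists p; split; auto. intro z; rewrite hp; split; [tauto |].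
  intro h; split; auto. destruct h as [x [xa [y [yb ->]]]].
  assert (Mx : M x) by (eapply trans_in; eauto). assert (My : M y) by (eapply trans_in; eauto).
  assert (xu : x ∈ u) by (apply hu; exists a; split; auto; apply hc; auto).
  assert (yu : y ∈ u) by (apply hu; exists b; split; auto; apply hc; auto).
  apply hw; split; [apply op_in; auto |].
  intros z k. apply hv; split.
  - eapply trans_in; [auto | exact k | apply op_in; auto].
  - intros t l. apply (op_spec M x y) in k; auto. destruct k as [k | k]; apply k in l.
    + subst; auto.
    + destruct l; subst; auto.
Qed.

Definition is_rel r a b : Prop :=
  forall z, z ∈ r -> exists x, x ∈ a /\ exists y, y ∈ b /\ z = op x y.

(** Separation inside the product: the element tested is a pair [z] whose coordinates are
    quantified, whence the three entries in front of [e]. *)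
Lemma rel_separation M (p : formula) (e : nat -> U) a b (Q : U -> U -> Prop) : zmodel M ->
  (forall z x y, M z -> M x -> M y -> reif M (env_cons y (env_cons x (env_cons z e))) p (Q x y)) ->
  M a -> M b -> env_in M e ->
  exists r, M r /\ is_rel r a b /\ forall x y, x ∈ a -> y ∈ b -> (op x y ∈ r <-> Q x y).
Proof.
  intros mM h Ma Mb he. destruct (product_in M a b mM Ma Mb) as [c [Mc hc]].
  assert (k : exists r, M r /\ forall z, z ∈ r <-> z ∈ c /\
     exists x, M x /\ exists y, M y /\ z = op x y /\ Q x y).
  { eapply separation with (e := e); auto. intros z Mz.
    apply reif_ex; intros x Mx. apply reif_ex; intros y My. apply reif_and; auto.
    eapply reif_pair; auto; look_tac. }
  destruct k as [r [Mr hr]]. exists r; split; auto. split.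
  - intros z k. apply hc. apply hr; auto.
  - intros x y xa yb.
    assert (Mx : M x) by (eapply trans_in; eauto). assert (My : M y) by (eapply trans_in; eauto).
    rewrite hr. split.
    + intros [_ (x' & Mx' & y' & My' & k & l)]. apply (op_inj M) in k; auto.
      destruct k; subst; auto.
    + intro k; split; [apply hc; eauto | eauto 6].
Qed.

End Sets.

Ltac relsep := eapply rel_separation; [assumption | intros; reify | assumption | assumption | env_tac].

(** * Bisimulations and the transitive collapse *)

Section Collapse.

Context {U : set_universe}.
Implicit Types (M : class U) (a b c d x y z r s t u v w X Y : U).

(** One step of the recursion for the transitive collapse of [(X, E)] with values in [Y]. *)
Definition step X Y (E F : U -> U -> Prop) x y : Prop :=
  (forall x', x' ∈ X -> E x' x -> exists y', y' ∈ Y /\ y' ∈ y /\ F x' y') /\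
  (forall y', y' ∈ Y -> y' ∈ y -> exists x', x' ∈ X /\ E x' x /\ F x' y').

Lemma step_mono X Y (E F G : U -> U -> Prop) x y :
  (forall u v, u ∈ X -> v ∈ Y -> F u v -> G u v) -> step X Y E F x y -> step X Y E G x y.
Proof.
  intros h [k l]; split.
  - intros x' a b. destruct (k x' a b) as (y' & c & d & f). eauto 6.
  - intros x' a b. destruct (l x' a b) as (y' & c & d & f). eauto 6.
Qed.

(** As [∈] is well founded, [F] is the union of all bisimulations belonging to [M]. *)
Lemma bisim_in M X Y r (E F : U -> U -> Prop) : zmodel M -> M X -> M Y -> M r ->
  (forall x x', x ∈ X -> x' ∈ X -> (op x' x ∈ r <-> E x' x)) ->
  (forall x y, x ∈ X -> y ∈ Y -> (F x y <-> step X Y E F x y)) ->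
  exists k, M k /\ is_rel k X Y /\ forall x y, x ∈ X -> y ∈ Y -> (op x y ∈ k <-> F x y).
Proof.
  intros mM MX MY Mr hr hF.
  pose (bis := fun K => forall x, x ∈ X -> forall y, y ∈ Y -> op x y ∈ K ->
    (forall x', x' ∈ X -> op x' x ∈ r -> exists y', y' ∈ Y /\ (y' ∈ y /\ op x' y' ∈ K)) /\
    (forall y', y' ∈ Y -> y' ∈ y -> exists x', x' ∈ X /\ (op x' x ∈ r /\ op x' y' ∈ K))).
  assert (h : exists k, M k /\ is_rel k X Y /\ forall x y, x ∈ X -> y ∈ Y ->
     (op x y ∈ k <-> exists K, M K /\ (bis K /\ op x y ∈ K))).
  { unfold bis; relsep. }
  destruct h as [k (Mk & rk & hk)]. exists k; split; auto; split; auto.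
  (* Each bisimulation is contained in [F], by induction on the second coordinate. *)
  assert (kF : forall K, bis K -> forall y x, x ∈ X -> y ∈ Y -> op x y ∈ K -> F x y).
  { intros K bK y; induction y as [y IH] using (well_founded_ind (mem_wf U)); intros x xX yY i.
    apply hF; auto. destruct (bK x xX y yY i) as [h1 h2]. split.
    - intros x' x'X l. destruct (h1 x' x'X) as (y' & c & d & f); [apply hr; auto | eauto 6].
    - intros y' y'Y l. destruct (h2 y' y'Y l) as (x' & c & d & f).
      apply hr in d; auto. eauto 6. }
  assert (bk : bis k).
  { intros x xX y yY i. apply hk in i; auto. destruct i as (K & MK & bK & i).
    destruct (bK x xX y yY i) as [h1 h2]. split.
    - intros x' x'X l. destruct (h1 x' x'X l) as (y' & c & d & f).
      exists y'; repeat split; auto; apply hk; eauto.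
    - intros y' y'Y l. destruct (h2 y' y'Y l) as (x' & c & d & f).
      exists x'; repeat split; auto; apply hk; eauto. }
  intros x y xX yY; split; [apply kF; auto |].
  revert x xX; induction y as [y IH] using (well_founded_ind (mem_wf U)). intros x xX i.
  apply hk; auto. apply hF in i; auto. destruct i as [i1 i2].
  assert (Mx : M x) by (eapply trans_in; eauto). assert (My : M y) by (eapply trans_in; eauto).
  (* By induction the pairs of [F] below (x, y) are in [k], so [k] with (x, y) added is again a
     bisimulation in [M]. *)
  assert (h : exists K, M K /\ is_rel K X Y /\ forall u v, u ∈ X -> v ∈ Y ->
     (op u v ∈ K <-> (op u v ∈ k \/ (u = x /\ v = y)))) by relsep.
  destruct h as [K (MK & rK & hK)]. exists K; split; auto. split; [| apply hK; auto].
  intros u uX v vY i. apply hK in i; auto. destruct i as [i | [-> ->]].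
  - destruct (bk u uX v vY i) as [h1 h2]. split.
    + intros x' x'X l. destruct (h1 x' x'X l) as (y' & c & d & f).
      exists y'; repeat split; auto; apply hK; auto.
    + intros y' y'Y l. destruct (h2 y' y'Y l) as (x' & c & d & f).
      exists x'; repeat split; auto; apply hK; auto.
  - split.
    + intros x' x'X l. apply hr in l; auto. destruct (i1 x' x'X l) as (y' & c & d & f).
      exists y'; repeat split; auto; apply hK; auto.
    + intros y' y'Y l. destruct (i2 y' y'Y l) as (x' & c & d & f).
      exists x'; repeat split; auto; [apply hr | apply hK]; auto.
Qed.

(** The least relation closed under [step], as an intersection over all relations of the ambient
    logic; no model enters. *)
Definition collapses X Y (E : U -> U -> Prop) x y : Prop :=
  forall F : U -> U -> Prop,
    (forall u v, u ∈ X -> v ∈ Y -> step X Y E F u v -> F u v) -> F x y.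

Lemma collapses_step X Y E x y : x ∈ X -> y ∈ Y -> (collapses X Y E x y <-> step X Y E (collapses X Y E) x y).
Proof.
  assert (h : forall x y, x ∈ X -> y ∈ Y -> step X Y E (collapses X Y E) x y -> collapses X Y E x y).
  { intros u v uX vY i F hF. apply hF; auto. eapply step_mono; [|exact i].
    intros u' v' _ _ k; apply k; auto. }
  intros xX yY; split; auto. intro i.
  apply (i (step X Y E (collapses X Y E))). intros u v uX vY k.
  eapply step_mono; [|exact k]. auto.
Qed.

(** As [Y] is transitive, [step] accounts for every element of a value, so a value is exactly the
    set of values of the predecessors of [x]. *)
Lemma collapses_unique X Y E : (forall y z, y ∈ Y -> z ∈ y -> z ∈ Y) ->
  forall y x y', x ∈ X -> y ∈ Y -> y' ∈ Y -> collapses X Y E x y -> collapses X Y E x y' -> y = y'.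
Proof.
  intros tY y; induction y as [y IH] using (well_founded_ind (mem_wf U)).
  intros x y' xX yY y'Y h h'. apply collapses_step in h, h'; auto.
  destruct h as [h1 h2], h' as [h1' h2']. apply mem_ext; intro z; split; intro k.
  - destruct (h2 z (tY y z yY k) k) as (x' & x'X & l & m).
    destruct (h1' x' x'X l) as (z' & z'Y & i & j).
    rewrite (IH z k x' z'); eauto.
  - destruct (h2' z (tY y' z y'Y k) k) as (x' & x'X & l & m).
    destruct (h1 x' x'X l) as (z' & z'Y & i & j).
    rewrite <- (IH z' i x' z); eauto.
Qed.

(** By induction on the common value, [x] and [x'] have the same predecessors. *)
Lemma collapses_inj X Y E :
  (forall x x', x ∈ X -> x' ∈ X -> (forall u, u ∈ X -> (E u x <-> E u x')) -> x = x') ->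
  forall y x x', x ∈ X -> x' ∈ X -> y ∈ Y -> collapses X Y E x y -> collapses X Y E x' y -> x = x'.
Proof.
  intros ext y; induction y as [y IH] using (well_founded_ind (mem_wf U)).
  intros x x' xX x'X yY h h'. apply collapses_step in h, h'; auto.
  destruct h as [h1 h2], h' as [h1' h2']. apply ext; auto. intros u uX; split; intro k.
  - destruct (h1 u uX k) as (z & zY & i & j). destruct (h2' z zY i) as (u' & u'X & l & m).
    rewrite (IH z i u u'); auto.
  - destruct (h1' u uX k) as (z & zY & i & j). destruct (h2 z zY i) as (u' & u'X & l & m).
    rewrite (IH z i u u'); auto.
Qed.

(** The closure hypothesis on [Y] replaces the missing axiom of replacement. *)
Lemma collapse M X Y r (E : U -> U -> Prop) : zmodel M -> M X -> M Y -> M r ->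
  (forall x x', x ∈ X -> x' ∈ X -> (op x' x ∈ r <-> E x' x)) ->
  (forall P : U -> Prop,
     (forall x, x ∈ X -> (forall x', x' ∈ X -> E x' x -> P x') -> P x) -> forall x, x ∈ X -> P x) ->
  (forall x p, x ∈ X -> M p -> (forall q, q ∈ p -> q ∈ Y) ->
     (forall q, q ∈ Y -> (q ∈ p <-> exists x', x' ∈ X /\ E x' x /\ collapses X Y E x' q)) -> p ∈ Y) ->
  exists k, M k /\ is_rel k X Y /\
    (forall x y, x ∈ X -> y ∈ Y -> (op x y ∈ k <-> collapses X Y E x y)) /\
    (forall x, x ∈ X -> exists y, y ∈ Y /\ collapses X Y E x y).
Proof.
  intros mM MX MY Mr hr ind clo.
  destruct (bisim_in M X Y r E (collapses X Y E)) as [k (Mk & rk & hk)]; auto.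
  { intros; apply collapses_step; auto. }
  exists k; repeat (split; auto). apply ind. intros x xX IH.
  assert (Mx : M x) by (eapply trans_in; eauto).
  (* The prospective value of [x], cut out of [Y] by separation; the closure hypothesis then makes
     it an element of [Y]. *)
  assert (h : exists p, M p /\ forall q, q ∈ p <-> q ∈ Y /\ exists x', x' ∈ X /\ (op x' x ∈ r /\ op x' q ∈ k))
    by sep.
  destruct h as [p [Mp hp]].
  assert (hp' : forall q, q ∈ Y -> (q ∈ p <-> exists x', x' ∈ X /\ E x' x /\ collapses X Y E x' q)).
  { intros q qY; rewrite hp; split.
    - intros [_ (x' & x'X & i & j)]. exists x'; split; auto; split; [apply hr | apply hk]; auto.
    - intros (x' & x'X & i & j). split; auto.
      exists x'; split; auto; split; [apply hr | apply hk]; auto. }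
  assert (pY : p ∈ Y).
  { apply (clo x); auto. intro q; rewrite hp; tauto. }
  exists p; split; auto. apply collapses_step; auto. split.
  - intros x' x'X i. destruct (IH x' x'X i) as (y & yY & j). exists y; repeat split; auto.
    apply hp'; eauto.
  - intros q qY i. apply hp'; auto.
Qed.

End Collapse.

(** * Ordinals and cardinalities *)

Section Ordinals.

Context {U : set_universe}.
Implicit Types (M : class U) (a b c d k x y z r s t u v w : U).

Definition trans a : Prop := forall y z, y ∈ a -> z ∈ y -> z ∈ a.

(** As membership is well founded, comparability follows ([ord_compare]), and for elements of a
    model this agrees with its own notion ([is_ordinal_abs]). *)
Definition ord a : Prop := trans a /\ forall y, y ∈ a -> trans y.

Lemma least_mem (P : U -> Prop) x : P x -> exists y, P y /\ forall z, z ∈ y -> ~ P z.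
Proof.
  induction x as [x IH] using (well_founded_ind (mem_wf U)). intro h.
  destruct (classic (exists z, z ∈ x /\ P z)) as [[z [k l]] | k]; eauto.
  exists x; split; auto. intros z l m; apply k; eauto.
Qed.

Lemma ord_in a b : b ∈ a -> ord a -> ord b.
Proof. intros l [h k]; split; auto. intros y m. apply k. eapply h; eauto. Qed.

Lemma ord_trans a b c : ord c -> a ∈ b -> b ∈ c -> a ∈ c.
Proof. intros [h _] k l; eapply h; eauto. Qed.

Lemma ord_compare a b : ord a -> ord b -> a ∈ b \/ a = b \/ b ∈ a.
Proof.
  revert b; induction a as [a IHa] using (well_founded_ind (mem_wf U)).
  intro b; induction b as [b IHb] using (well_founded_ind (mem_wf U)). intros oa ob.
  destruct (classic (exists c, c ∈ a /\ ~ c ∈ b)) as [[c [ca cb]] | h].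
  { destruct (IHa c ca b (ord_in a c ca oa) ob) as [k | [k | k]].
    - contradiction.
    - subst; auto.
    - right; right. eapply ord_trans; eauto. }
  destruct (classic (exists c, c ∈ b /\ ~ c ∈ a)) as [[c [cb ca]] | k].
  { destruct (IHb c cb oa (ord_in b c cb ob)) as [l | [l | l]].
    - left. eapply ord_trans; eauto.
    - subst; auto.
    - contradiction. }
  right; left. apply mem_ext; intro z; split; intro l; apply NNPP; intro m; eauto.
Qed.

Lemma ord_subset a b : ord a -> ord b -> (forall z, z ∈ a -> z ∈ b) -> a ∈ b \/ a = b.
Proof.
  intros oa ob h. destruct (ord_compare a b oa ob) as [k | [k | k]]; auto.
  apply h in k. destruct (mem_irrefl b k).
Qed.

Lemma ord_le_trans a b c : ord c -> a ∈ b \/ a = b -> b ∈ c -> a ∈ c.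
Proof. intros oc [h | ->] k; auto. eapply ord_trans; eauto. Qed.

Lemma ord_max a b c : ord c -> a ∈ c -> b ∈ c ->
  exists m, m ∈ c /\ (a ∈ m \/ a = m) /\ (b ∈ m \/ b = m).
Proof.
  intros oc ac bc. destruct (ord_compare a b) as [h | [h | h]]; [eapply ord_in; eauto .. | | |].
  - exists b; auto.
  - exists b; auto.
  - exists a; auto.
Qed.

Lemma is_ordinal_abs M a : zmodel M -> M a -> (is_ordinal M a <-> ord a).
Proof.
  intros mM Ma. split.
  - intros (h & k & _). assert (t : trans a).
    { intros y z ya zy. apply (h y); auto; eapply trans_in; eauto. eapply trans_in; eauto. }
    split; auto. intros y ya z w zy wz.
    assert (za : z ∈ a) by eauto. assert (wa : w ∈ a) by eauto.
    assert (My : M y) by (eapply trans_in; eauto). assert (Mw : M w) by (eapply trans_in; eauto).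
    destruct (k w Mw y My wa ya) as [l | [l | l]]; auto.
    + subst. destruct (mem_asym _ _ zy wz).
    + exfalso.
      assert (cyc : forall p q r, p ∈ q -> q ∈ r -> r ∈ p -> False).
      { intro p; induction p as [p IH] using (well_founded_ind (mem_wf U)).
        intros q r pq qr rp. exact (IH r rp p q rp pq qr). }
      exact (cyc w z y wz zy l).
  - intro oa. split; [|split].
    + intros x Mx xa z Mz zx. eapply ord_trans; eauto.
    + intros x Mx y My xa ya. apply ord_compare; eauto using ord_in.
    + intros s Ms sub [x [Mx xs]].
      destruct (least_mem (fun m => m ∈ s) x xs) as [m [ms hm]].
      exists m; split; [eapply trans_in; eauto | split; auto].
      intros z _ zs zm; exact (hm z zm zs).
Qed.

(** [f] need not be functional: it is the inverse of a partial map from [k] onto [a]. *)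
Definition embeds M a k : Prop :=
  exists f, M f /\ (forall x, x ∈ a -> exists y, y ∈ k /\ op x y ∈ f) /\
    (forall x x' y, x ∈ a -> x' ∈ a -> y ∈ k -> op x y ∈ f -> op x' y ∈ f -> x = x').

Lemma equinumerous_emb M a k : zmodel M -> M a -> M k -> equinumerous M a k -> embeds M a k.
Proof.
  intros mM Ma Mk (f & Mf & ((h1 & h2 & h3) & h4) & h5 & h6).
  assert (Ia : forall x, x ∈ a -> M x) by (intros; eapply trans_in; eauto).
  assert (Ik : forall x, x ∈ k -> M x) by (intros; eapply trans_in; eauto).
  exists f; split; auto. split.
  - intros x xa. destruct (h2 x) as (y & My & hy); auto.
    exists y; split; [apply (h4 x); auto |]. apply (related_abs M); auto.
  - intros x x' y xa x'a yk hx hx'. apply (h5 x (Ia x xa) x' (Ia x' x'a) y (Ik y yk)); apply related_abs; auto.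
Qed.

Lemma emb_sub M N a b k : subclass M N -> (forall x, x ∈ b -> x ∈ a) -> embeds M a k -> embeds N b k.
Proof.
  intros MN ba (f & Mf & h & i). exists f; split; auto. split; auto.
  intros; eapply i; eauto.
Qed.

(** * The order type of a set embedded in an ordinal *)

Section EmbCard.

Context (M : class U) (a k f : U) (mM : zmodel M) (Ma : M a) (Mk : M k) (ok : ord k) (Mf : M f).
Context (tot : forall x, x ∈ a -> exists y, y ∈ k /\ op x y ∈ f).
Context (inj : forall x x' y, x ∈ a -> x' ∈ a -> y ∈ k -> op x y ∈ f -> op x' y ∈ f -> x = x').

(** [f] may relate [x] to several elements of [k]; the least one is taken as its code. *)
Let code x y := y ∈ k /\ op x y ∈ f /\ forall y', y' ∈ y -> ~ op x y' ∈ f.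

(** The comparison of least codes ([E_code]), phrased without them. *)
Let E x' x := exists y', y' ∈ k /\ (op x' y' ∈ f /\ forall y, y ∈ k -> op x y ∈ f -> y' ∈ y).

Lemma code_total x : x ∈ a -> exists y, code x y.
Proof.
  intro xa. destruct (tot x xa) as [y h].
  destruct (least_mem (fun y => y ∈ k /\ op x y ∈ f) y h) as [z [[h1 h2] h3]].
  exists z; repeat split; auto. intros y' l m; apply (h3 y' l); split; auto. eapply ord_trans; eauto.
Qed.

Lemma E_code x' x y' y : x ∈ a -> x' ∈ a -> code x' y' -> code x y -> (E x' x <-> y' ∈ y).
Proof.
  intros xa x'a (c1 & c2 & c3) (d1 & d2 & d3). split.
  - intros (z & zk & z1 & z2). specialize (z2 y d1 d2).
    destruct (ord_compare y' z) as [l | [l | l]]; eauto using ord_in.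
    + eapply ord_trans; eauto using ord_in.
    + subst; auto.
    + destruct (c3 z l z1).
  - intro l. exists y'; split; auto; split; auto. intros z zk i.
    destruct (ord_compare y z) as [m | [m | m]]; eauto using ord_in.
    + eapply ord_trans; eauto using ord_in.
    + subst; auto.
    + destruct (d3 z m i).
Qed.

Lemma code_inj x x' y : x ∈ a -> x' ∈ a -> code x y -> code x' y -> x = x'.
Proof. intros xa x'a (c1 & c2 & c3) (d1 & d2 & d3). eauto. Qed.

Lemma E_ind (P : U -> Prop) :
  (forall x, x ∈ a -> (forall x', x' ∈ a -> E x' x -> P x') -> P x) -> forall x, x ∈ a -> P x.
Proof.
  intros h. assert (g : forall y x, x ∈ a -> code x y -> P x).
  { intro y; induction y as [y IH] using (well_founded_ind (mem_wf U)). intros x xa c.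
    apply h; auto. intros x' x'a e. destruct (code_total x' x'a) as [y' c'].
    apply (IH y'); auto. apply (E_code x' x); auto. }
  intros x xa. destruct (code_total x xa) as [y c]; eauto.
Qed.

Lemma E_trans x y z : x ∈ a -> y ∈ a -> z ∈ a -> E x y -> E y z -> E x z.
Proof.
  intros xa ya za e e'.
  destruct (code_total x xa) as [cx hx], (code_total y ya) as [cy hy], (code_total z za) as [cz hz].
  apply (E_code x z cx cz); auto. apply (E_code x y cx cy) in e; auto. apply (E_code y z cy cz) in e'; auto.
  eapply ord_trans; eauto. eapply ord_in; eauto. apply hz.
Qed.

Lemma E_ext x x' : x ∈ a -> x' ∈ a -> (forall u, u ∈ a -> (E u x <-> E u x')) -> x = x'.
Proof.
  intros xa x'a h.
  destruct (code_total x xa) as [c hc], (code_total x' x'a) as [c' hc'].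
  destruct (ord_compare c c') as [l | [l | l]].
  - eapply ord_in; eauto; apply hc.
  - eapply ord_in; eauto; apply hc'.
  - apply (E_code x x') in l; auto. apply h in l; auto. apply (E_code x x c c) in l; auto.
    destruct (mem_irrefl c l).
  - subst; eapply code_inj; eauto.
  - apply (E_code x' x) in l; auto. apply h in l; auto. apply (E_code x' x' c' c') in l; auto.
    destruct (mem_irrefl c' l).
Qed.

(** The value of [x] consists of values of smaller elements, each at most its own code and so below
    [y]. This keeps the collapse inside [k]. *)
Lemma collapses_le_code x y q : x ∈ a -> q ∈ k -> code x y -> collapses a k E x q -> q ∈ y \/ q = y.
Proof.
  intro xa; revert x xa y q. apply (E_ind (fun x => forall y q, q ∈ k -> code x y ->
     collapses a k E x q -> q ∈ y \/ q = y)).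
  intros x xa IH y q qk c h. apply ord_subset; [eapply ord_in; eauto | eapply ord_in; eauto; apply c |].
  intros z zq. apply collapses_step in h; auto. destruct h as [_ h].
  assert (zk : z ∈ k) by (eapply ord_trans; eauto).
  destruct (h z zk zq) as (x' & x'a & e & i).
  destruct (code_total x' x'a) as [y' c'].
  assert (l := IH x' x'a e y' z zk c' i).
  apply (E_code x' x y' y) in e; auto.
  eapply ord_le_trans; eauto. eapply ord_in; eauto; apply c.
Qed.

(** The collapse of (a, E) maps [a] bijectively onto its order type. *)
Lemma emb_ordinal : exists b, M b /\ ord b /\ (b ∈ k \/ b = k) /\ equinumerous M a b.
Proof.
  assert (h : exists r, M r /\ is_rel r a a /\ forall x' x, x' ∈ a -> x ∈ a -> (op x' x ∈ r <-> E x' x)).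
  { unfold E; relsep. }
  destruct h as (r & Mr & _ & hr).
  assert (tk : forall y z, y ∈ k -> z ∈ y -> z ∈ k) by exact (proj1 ok).
  assert (down : forall x z w, x ∈ a -> z ∈ k -> collapses a k E x z -> w ∈ z ->
            exists x', x' ∈ a /\ E x' x /\ collapses a k E x' w).
  { intros x z w xa zk c wz. apply collapses_step in c; auto. apply c; auto. eauto. }
  destruct (collapse M a k r E) as (g & Mg & rg & hg & tg); auto.
  { exact E_ind. }
  { intros x p xa Mp pk hp. destruct (code_total x xa) as [y c].
    assert (yk : y ∈ k) by apply c.
    assert (oP : ord p).
    { split.
      - intros z w zp wz. assert (zk := pk z zp). apply hp in zp; auto.
        destruct zp as (x' & x'a & e & i). destruct (down x' z w x'a zk i wz) as (x2 & h1 & h2 & h3).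
        apply hp; eauto. exists x2; split; auto; split; auto. eapply E_trans with (y := x'); eauto.
      - intros z zp. eapply ok; eauto. }
    (* [p] is an ordinal contained in the least code [y] of [x], so p ≤ y ∈ k. *)
    apply (ord_le_trans p y k); auto. apply ord_subset; auto; [eapply ord_in; eauto |].
    intros z zp. assert (zk := pk z zp). apply hp in zp; auto. destruct zp as (x' & x'a & e & i).
    destruct (code_total x' x'a) as [y' c']. apply (E_code x' x y' y) in e; auto.
    apply (ord_le_trans z y' y); [eapply ord_in; eauto | eapply collapses_le_code; eauto | auto]. }
  assert (h : exists b, M b /\ forall q, q ∈ b <-> q ∈ k /\ exists x, x ∈ a /\ op x q ∈ g) by sep.
  destruct h as (b & Mb & hb).
  assert (ob : ord b).
  { split.
    - intros z w zb wz. apply hb in zb. destruct zb as (zk & x & xa & i). apply hg in i; auto.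
      destruct (down x z w xa zk i wz) as (x2 & h1 & h2 & h3).
      apply hb. split; eauto. exists x2; split; auto. apply hg; eauto.
    - intros z zb. apply hb in zb. eapply ok; apply zb. }
  exists b; split; auto. split; auto. split.
  { apply ord_subset; auto. intro z; rewrite hb; tauto. }
  assert (Ia : forall x, x ∈ a -> M x) by (intros; eapply trans_in; eauto).
  assert (Ib : forall x, x ∈ b -> M x) by (intros; eapply trans_in; eauto).
  assert (bk : forall x, x ∈ b -> x ∈ k) by (intro x; rewrite hb; tauto).
  assert (rel : forall x y, M x -> M y -> related M g x y -> x ∈ a /\ y ∈ b /\ collapses a k E x y).
  { intros x y Mx My i. apply related_abs in i; auto.
    destruct (rg _ i) as (x1 & x1a & y1 & y1k & j).
    apply (op_inj M) in j; auto; [| eapply trans_in; eauto]. destruct j; subst x1 y1.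
    split; auto. split; [apply hb; eauto | apply hg; auto]. }
  assert (tot' : forall x, x ∈ a -> exists y, M y /\ related M g x y).
  { intros x xa. destruct (tg x xa) as (y & yk & i). assert (My : M y) by (eapply trans_in; eauto).
    exists y; split; auto. apply related_abs; auto. apply hg; auto. }
  exists g; split; auto. split; [split; [split; [|split]|] | split].
  - intros p Mp pg. destruct (rg p pg) as (x & xa & y & yk & ->).
    assert (My : M y) by (eapply trans_in; eauto).
    exists x; split; auto. exists y; split; auto. split; auto. apply opair_abs; auto.
  - intros x Mx xa. apply tot'; auto.
  - intros x Mx y My y' My' i i'. apply rel in i, i'; auto.
    apply (collapses_unique a k E tk y x y'); auto; try tauto; apply bk; tauto.
  - intros x Mx y My i. apply rel in i; tauto.
  - intros x Mx x' Mx' y My i i'. apply rel in i, i'; auto.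
    apply (collapses_inj a k E E_ext y x x'); auto; try tauto; apply bk; tauto.
  - intros y My yb. apply hb in yb. destruct yb as (yk & x & xa & i).
    exists x; split; auto. apply related_abs; auto.
Qed.

End EmbCard.

(** [emb_ordinal] supplies an ordinal equinumerous with [a]; the least such ordinal is the
    cardinality. *)
Lemma emb_cardinality M a k : zmodel M -> M a -> M k -> ord k -> embeds M a k ->
  exists c, M c /\ (c ∈ k \/ c = k) /\ is_cardinality M a c.
Proof.
  intros mM Ma Mk ok (f & Mf & tot & inj).
  destruct (emb_ordinal M a k f mM Ma Mk ok Mf tot inj) as (b & hb).
  destruct (least_mem (fun b => M b /\ ord b /\ (b ∈ k \/ b = k) /\ equinumerous M a b) b hb)
    as (c & (Mc & oc & ck & e) & l).
  exists c; split; auto; split; auto. split; [apply is_ordinal_abs; auto | split; auto].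
  intros d Md dc e'. apply (l d dc). split; auto; split; [eapply ord_in; eauto | split; auto].
  left. destruct ck as [ck | ->]; auto. eapply ord_trans; eauto.
Qed.

Lemma emb_size_le M a d : zmodel M -> M a -> M d -> ord d -> embeds M a d -> size_le M a d.
Proof.
  intros mM Ma Md od e. destruct (emb_cardinality M a d) as (c & Mc & cb & h); auto.
  exists c; auto.
Qed.

End Ordinals.

(** * Regular cardinals *)

Section Regularity.

Context {U : set_universe}.
Implicit Types (M : class U) (a b c d k x y z r s t u v w : U).

(** The functions are partial and the bound is strict. [M] only says where [f] is taken from, so
    smaller classes inherit the property ([regular_in_sub]). *)
Definition regular_in M d : Prop :=
  forall b f, b ∈ d -> M f ->
    (forall x y y', x ∈ b -> y ∈ d -> y' ∈ d -> op x y ∈ f -> op x y' ∈ f -> y = y') ->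
    exists c, c ∈ d /\ forall x y, x ∈ b -> y ∈ d -> op x y ∈ f -> y ∈ c.

Definition limit d : Prop :=
  (exists x, x ∈ d) /\ forall x, x ∈ d -> exists s, s ∈ d /\ forall z, z ∈ s <-> z ∈ x \/ z = x.

Lemma succ_in M x : zmodel M -> M x -> exists s, M s /\ forall z, z ∈ s <-> z ∈ x \/ z = x.
Proof.
  intros mM Mx. destruct (upair_in M x x mM Mx Mx) as [t [Mt ht]].
  destruct (upair_in M x t mM Mx Mt) as [u [Mu hu]].
  destruct (union_in M u mM Mu) as [s [Ms hs]]. exists s; split; auto.
  intro z; rewrite hs; split.
  - intros [y [yu zy]]. apply hu in yu. destruct yu; subst; auto. apply ht in zy. tauto.
  - intros [h | ->]; [exists x | exists t]; rewrite hu; auto. split; auto. apply ht; auto.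
Qed.

Lemma ord_succ x s : ord x -> (forall z, z ∈ s <-> z ∈ x \/ z = x) -> ord s.
Proof.
  intros ox hs. split.
  - intros y z ys zy. apply hs; left. apply hs in ys. destruct ys; subst; auto. eapply ord_trans; eauto.
  - intros y ys. apply hs in ys. destruct ys as [ys | ->]; [exact (proj2 ox y ys) | exact (proj1 ox)].
Qed.

Lemma omega_limit M w : zmodel M -> M w -> is_omega M w -> ord w /\ limit w /\
  exists e, e ∈ w /\ forall z, ~ z ∈ e.
Proof.
  intros mM Mw (ow & [x [Mx xw]] & hs & _). apply (is_ordinal_abs M) in ow; auto.
  split; [auto | split; [unfold limit; split |]].
  - eauto.
  - intros n nw. assert (Mn : M n) by (eapply trans_in; eauto).
    destruct (hs n Mn nw) as (s & Ms & h & sw). exists s; split; auto.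
    intro z; split; intro k; apply h; auto.
    + eapply trans_in; eauto.
    + destruct k; subst; auto. eapply trans_in; eauto.
  - destruct (least_mem (fun z => z ∈ w) x xw) as (e & ew & he). exists e; split; auto.
    intros z ze. apply (he z ze). eapply ord_trans; eauto.
Qed.

(** Hilbert's hotel: if d = x ∪ {x}, shifting ω by one makes room for [x] at 0, and [d] embeds into
    its element [x]. *)
Lemma infinite_cardinal_limit M d : zmodel M -> M d -> is_cardinal M d -> infinite_ordinal M d -> limit d.
Proof.
  intros mM Md [od cd] [_ (w & Mw & hw & wd)]. apply (is_ordinal_abs M) in od; auto.
  destruct (omega_limit M w mM Mw hw) as (ow & lw & e & ew & he).
  split; [destruct wd; subst; eauto|].
  intros x xd. assert (Mx : M x) by (eapply trans_in; eauto).
  destruct (succ_in M x mM Mx) as (s & Ms & hs).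
  exists s; split; auto.
  assert (os : ord s) by (apply (ord_succ x); [eapply ord_in; eauto | auto]).
  destruct (ord_subset s d) as [h | h]; auto.
  { intros z zs. apply hs in zs. destruct zs; subst; auto. eapply ord_trans; eauto. }
  subst s. exfalso.
  (* Either ω ∈ x ∪ {x}, or ω = x ∪ {x}; the latter contradicts closure of ω under successor. *)
  assert (wx : forall z, z ∈ w -> z ∈ x).
  { destruct wd as [wd | ->].
    - apply hs in wd. destruct wd; subst; auto. intros; eapply ord_trans; eauto. eapply ord_in; eauto.
    - destruct (proj2 lw x xd) as (s & sd & h). replace s with d in sd.
      + destruct (mem_irrefl d sd).
      + apply mem_ext; intro z; rewrite h, hs; tauto. }
  assert (Me : M e) by (eapply trans_in; eauto).
  assert (h : exists f, M f /\ is_rel f d x /\ forall u v, u ∈ d -> v ∈ x -> (op u v ∈ f <->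
     ((u = x /\ v = e) \/ (u ∈ w /\ u ∈ v /\ (forall z, z ∈ v -> z ∈ u \/ z = u)) \/
      (u ∈ x /\ ~ u ∈ w /\ v = u)))) by relsep.
  destruct h as (f & Mf & _ & hf).
  assert (emb : embeds M d x).
  { exists f; split; auto. split.
    - intros u ud. destruct (classic (u = x)) as [-> | ux].
      + exists e. split; auto. apply hf; auto.
      + assert (u ∈ x) by (apply hs in ud; tauto).
        destruct (classic (u ∈ w)) as [uw | uw].
        * destruct (proj2 lw u uw) as (v & vw & hv). exists v; split; auto. apply hf; auto.
          right; left. rewrite hv. split; auto. split; auto. intro z; apply hv.
        * exists u; split; auto. apply hf; auto 6.
    - intros u u' v ud u'd vx i i'. apply hf in i, i'; auto.
      assert (sw : forall u, u ∈ w -> u ∈ v -> (forall z, z ∈ v -> z ∈ u \/ z = u) -> v ∈ w).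
      { intros p pw pv hv. destruct (proj2 lw p pw) as (v' & v'w & hv').
        replace v with v'; auto. apply mem_ext; intro z; rewrite hv'; split; auto.
        intros [k | ->]; auto. eapply ord_trans; eauto. eapply ord_in; eauto. eapply ord_in; eauto. }
      destruct i as [[-> ->] | [(i1 & i2 & i3) | (i1 & i2 & ->)]],
        i' as [[-> i'] | [(j1 & j2 & j3) | (j1 & j2 & j3)]]; subst; auto;
        try solve [exfalso; first [contradiction | eapply he; eassumption | eauto]].
      destruct (i3 _ j2) as [k | k]; auto. destruct (j3 _ i2) as [l | l]; auto.
      destruct (mem_asym _ _ k l). }
  destruct (emb_cardinality M d x mM Md Mx) as (c & Mc & cx & (_ & q & _)); auto.
  { eapply ord_in; eauto. }
  apply (cd c); auto. eapply ord_le_trans; eauto.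
Qed.

Lemma regular_cardinal_regular_in M d : zmodel M -> regular_cardinal M d -> ord d /\ limit d /\ regular_in M d.
Proof.
  intros mM (Md & cd & inf & hr).
  assert (od : ord d) by (apply (is_ordinal_abs M); auto; apply cd).
  assert (ld : limit d) by (eapply infinite_cardinal_limit; eauto).
  split; auto; split; auto. intros b f bd Mf hf.
  assert (Mb : M b) by (eapply trans_in; eauto).
  destruct (proj1 ld) as [e ed]. assert (Me : M e) by (eapply trans_in; eauto).
  (* Regularity is stated for total functions, so arguments without a value are sent to [e]. *)
  assert (h : exists g, M g /\ is_rel g b d /\ forall x y, x ∈ b -> y ∈ d -> (op x y ∈ g <->
     (op x y ∈ f \/ ((forall y', y' ∈ d -> ~ op x y' ∈ f) /\ y = e)))) by relsep.
  destruct h as (g & Mg & rg & hg).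
  assert (rel : forall x y, M x -> M y -> related M g x y ->
     x ∈ b /\ y ∈ d /\ (op x y ∈ f \/ ((forall y', y' ∈ d -> ~ op x y' ∈ f) /\ y = e))).
  { intros x y Mx My i. apply related_abs in i; auto.
    destruct (rg _ i) as (x1 & x1a & y1 & y1k & j).
    apply (op_inj M) in j; auto; [| eapply trans_in; eauto ..]. destruct j; subst x1 y1.
    split; auto. split; auto. apply hg; auto. }
  destruct (hr b Mb bd g Mg) as (c & Mc & c1 & c2).
  - split; [split; [|split]|].
    + intros p Mp pg. destruct (rg p pg) as (x & xa & y & yk & ->).
      assert (Mx : M x) by (eapply trans_in; eauto). assert (My : M y) by (eapply trans_in; eauto).
      exists x; split; auto. exists y; split; auto. split; auto. apply opair_abs; auto.
    + intros x Mx xb. destruct (classic (exists y, y ∈ d /\ op x y ∈ f)) as [(y & yd & i) | n].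
      * assert (My : M y) by (eapply trans_in; eauto).
        exists y; split; auto. apply related_abs; auto. apply hg; auto.
      * exists e; split; auto. apply related_abs; auto. apply hg; auto. right; split; auto.
        intros y' y'd i; apply n; eauto.
    + intros x Mx y My y' My' i i'. apply rel in i, i'; auto.
      destruct i as (i1 & i2 & [i3 | [i3 i4]]), i' as (j1 & j2 & [j3 | [j3 j4]]); subst; auto.
      * eapply hf; eauto.
      * destruct (j3 y i2 i3).
      * destruct (i3 y' j2 j3).
    + intros x Mx y My i. apply rel in i; tauto.
  (* [c] may be attained as a value; its successor is a strict bound. *)
  - destruct (proj2 ld c c1) as (s & sd & hs). exists s; split; auto.
    intros x y xb yd i. apply hs.
    assert (Mx : M x) by (eapply trans_in; eauto). assert (My : M y) by (eapply trans_in; eauto).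
    apply (c2 x Mx y My). apply related_abs; auto. apply hg; auto.
Qed.

Lemma regular_in_sub M N d : subclass M N -> regular_in N d -> regular_in M d.
Proof. intros MN h b f bd Mf; apply h; auto. Qed.

End Regularity.

(** * Gödel's pairing function *)

Section Pairing.

Context {U : set_universe}.
Implicit Types (M : class U) (a b c d k x y z r s t u v w : U).

Definition is_max a b m : Prop := (a ∈ b /\ m = b) \/ (~ a ∈ b /\ m = a).

Definition lex a' b' a b : Prop :=
  exists m' m, is_max a' b' m' /\ is_max a b m /\
    (m' ∈ m \/ (m' = m /\ (a' ∈ a \/ (a' = a /\ b' ∈ b)))).

(** Gödel's ordering of pairs, on codes. *)
Definition gless d p' p : Prop :=
  exists a', a' ∈ d /\ exists b', b' ∈ d /\ exists a, a ∈ d /\ exists b, b ∈ d /\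
  exists m', m' ∈ d /\ exists m, m ∈ d /\ (p' = op a' b' /\ p = op a b /\
    is_max a' b' m' /\ is_max a b m /\
    (m' ∈ m \/ (m' = m /\ (a' ∈ a \/ (a' = a /\ b' ∈ b))))).

Lemma is_max_total a b : exists m, is_max a b m.
Proof. unfold is_max; destruct (classic (a ∈ b)); eauto. Qed.

Lemma is_max_unique a b m m' : is_max a b m -> is_max a b m' -> m = m'.
Proof. unfold is_max; intros [[] | []] [[] | []]; subst; auto; contradiction. Qed.

Lemma is_max_in a b m d : a ∈ d -> b ∈ d -> is_max a b m -> m ∈ d.
Proof. unfold is_max; intros ? ? [[] | []]; subst; auto. Qed.

(** Nested inductions on the maximum, the first and the second coordinate. *)
Lemma lex_ind d (P : U -> U -> Prop) :
  (forall a b, a ∈ d -> b ∈ d -> (forall a' b', a' ∈ d -> b' ∈ d -> lex a' b' a b -> P a' b') -> P a b) ->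
  forall a b, a ∈ d -> b ∈ d -> P a b.
Proof.
  intro h. assert (g : forall m a b, is_max a b m -> a ∈ d -> b ∈ d -> P a b).
  { intro m; induction m as [m IHm] using (well_founded_ind (mem_wf U)).
    intro a; induction a as [a IHa] using (well_founded_ind (mem_wf U)).
    intro b; induction b as [b IHb] using (well_founded_ind (mem_wf U)).
    intros hm ad bd. apply h; auto. intros a' b' a'd b'd (m1 & m2 & i & j & l).
    assert (m2 = m) by (eapply is_max_unique; eauto). subst m2.
    destruct l as [l | [-> [l | [-> l]]]]; eauto. }
  intros a b ad bd. destruct (is_max_total a b); eauto.
Qed.

Lemma lex_total d a b a' b' : ord d -> a ∈ d -> b ∈ d -> a' ∈ d -> b' ∈ d ->
  lex a b a' b' \/ (a = a' /\ b = b') \/ lex a' b' a b.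
Proof.
  intros od ad bd a'd b'd.
  destruct (is_max_total a b) as [m hm], (is_max_total a' b') as [m' hm'].
  assert (cmp : forall x y, x ∈ d -> y ∈ d -> x ∈ y \/ x = y \/ y ∈ x)
    by (intros; apply ord_compare; eapply ord_in; eauto).
  assert (md : m ∈ d) by (eapply is_max_in; [| | exact hm]; auto).
  assert (m'd : m' ∈ d) by (eapply is_max_in; [| | exact hm']; auto).
  assert (l1 : m ∈ m' \/ (m = m' /\ (a ∈ a' \/ (a = a' /\ b ∈ b'))) -> lex a b a' b')
    by (intro; exists m, m'; auto).
  assert (l2 : m' ∈ m \/ (m' = m /\ (a' ∈ a \/ (a' = a /\ b' ∈ b))) -> lex a' b' a b)
    by (intro; exists m', m; auto).
  destruct (cmp m m' md m'd) as [i | [<- | i]]; auto.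
  destruct (cmp a a' ad a'd) as [j | [<- | j]]; auto 8.
  destruct (cmp b b' bd b'd) as [l | [<- | l]]; auto 8.
Qed.

Lemma lex_irrefl a b : ~ lex a b a b.
Proof.
  intros (m & m' & h & h' & k). replace m' with m in k by (eapply is_max_unique; eauto).
  destruct k as [k | [_ [k | [_ k]]]]; eapply mem_irrefl; eauto.
Qed.

Lemma lex_trans d a b a' b' a'' b'' : ord d -> a ∈ d -> b ∈ d -> a' ∈ d -> b' ∈ d -> a'' ∈ d -> b'' ∈ d ->
  lex a b a' b' -> lex a' b' a'' b'' -> lex a b a'' b''.
Proof.
  intros od ad bd a'd b'd a''d b''d (m & m' & h & h' & k) (m1 & m'' & h1 & h'' & k').
  assert (m1 = m') by (eapply is_max_unique; eauto); subst m1.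
  exists m, m''; split; auto; split; auto.
  assert (tr : forall x y z, z ∈ d -> x ∈ y -> y ∈ z -> x ∈ z).
  { intros x y z zd. apply ord_trans. eapply ord_in; eauto. }
  assert (m'' ∈ d) by (eapply is_max_in; [| | exact h'']; auto).
  destruct k as [k | [-> [k | [-> k]]]], k' as [k' | [<- [k' | [<- k']]]]; eauto 8.
Qed.

(** Take [g] to be the successor of the maximum. The pairs below (a, b) then lie in g × g, which by
    [no_square_map] cannot be mapped onto [d]. *)
Lemma lex_bounded d a b : ord d -> limit d -> a ∈ d -> b ∈ d ->
  exists g, g ∈ d /\ forall a' b', a' ∈ d -> b' ∈ d -> lex a' b' a b -> a' ∈ g /\ b' ∈ g.
Proof.
  intros od ld ad bd. destruct (is_max_total a b) as [m hm].
  assert (md : m ∈ d) by (eapply is_max_in; [| | exact hm]; auto).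
  destruct (proj2 ld m md) as (g & gd & hg). exists g; split; auto.
  intros a' b' a'd b'd (m' & m1 & h' & h1 & k).
  assert (m1 = m) by (eapply is_max_unique; eauto); subst m1.
  assert (mm : m' ∈ g) by (apply hg; destruct k as [k | [k _]]; auto).
  assert (og : ord g) by (eapply ord_in; eauto).
  destruct h' as [[h' ->] | [h' ->]]; split; auto.
  - eapply ord_trans; eauto.
  - apply (ord_le_trans b' a' g); auto. destruct (ord_compare b' a') as [l | [l | l]]; auto.
    + eapply ord_in; eauto.
    + eapply ord_in; eauto.
    + contradiction.
Qed.

Lemma lex_square a b g : a ∈ g -> b ∈ g -> lex a b g g.
Proof.
  intros ag bg. destruct (is_max_total a b) as [m hm]. exists m, g; split; auto. split.
  - right; split; auto. apply mem_irrefl.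
  - left; eapply is_max_in; [| | exact hm]; auto.
Qed.

Definition is_square d X : Prop := forall z, z ∈ X <-> exists x, x ∈ d /\ exists y, y ∈ d /\ z = op x y.

(** The value of Gödel's pairing function at (a, b). As no model is mentioned, the pairing functions
    of V, V' and W agree, which is what lets one model decode a subset of [d] coded in another. *)
Definition paired d a b y : Prop := forall X, is_square d X -> collapses X d (gless d) (op a b) y.

Section PairingIn.

Context (M : class U) (d : U) (mM : zmodel M) (Md : M d) (od : ord d) (ld : limit d) (rd : regular_in M d).

Lemma gless_lex a b a' b' : a ∈ d -> b ∈ d -> a' ∈ d -> b' ∈ d ->
  (gless d (op a' b') (op a b) <-> lex a' b' a b).
Proof.
  intros ad bd a'd b'd.
  assert (I : forall x, x ∈ d -> M x) by (intros; eapply trans_in; eauto).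
  split.
  - intros (a1 & h1 & b1 & h2 & a2 & h3 & b2 & h4 & m' & h5 & m & h6 & e1 & e2 & h).
    apply (op_inj M) in e1, e2; auto. destruct e1, e2; subst. exists m', m; tauto.
  - intros (m' & m & h & h' & k).
    exists a'; split; auto. exists b'; split; auto. exists a; split; auto. exists b; split; auto.
    exists m'; split; [eapply is_max_in; [| | exact h]; auto |].
    exists m; split; [eapply is_max_in; [| | exact h']; auto |]. tauto.
Qed.

(** Regularity is used twice: on each fiber of the first coordinate, and then on the suprema of the fibers. *)
Lemma no_square_map g h : g ∈ d -> M h ->
  (forall q, q ∈ d -> exists u, u ∈ g /\ exists v, v ∈ g /\ op (op u v) q ∈ h) ->
  (forall u v q q', u ∈ g -> v ∈ g -> q ∈ d -> q' ∈ d -> op (op u v) q ∈ h -> op (op u v) q' ∈ h -> q = q') ->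
  False.
Proof.
  intros gd Mh sur fn. assert (Mg : M g) by (eapply trans_in; eauto).
  assert (bd : forall u, u ∈ g -> exists c, c ∈ d /\
    forall v, v ∈ g -> forall q, q ∈ d -> op (op u v) q ∈ h -> q ∈ c).
  { intros u ug. assert (Mu : M u) by (eapply trans_in; eauto).
    assert (hf : exists f, M f /\ is_rel f g d /\ forall v q, v ∈ g -> q ∈ d -> (op v q ∈ f <-> op (op u v) q ∈ h))
      by relsep.
    destruct hf as (f & Mf & _ & hf). destruct (rd g f gd Mf) as (c & cd & hc).
    - intros v q q' vg qd q'd i i'. apply hf in i, i'; auto. eapply (fn u v); eauto.
    - exists c; split; auto. intros v vg q qd i. apply (hc v); auto. apply hf; auto. }
  assert (hs : exists s, M s /\ is_rel s g d /\ forall u c, u ∈ g -> c ∈ d -> (op u c ∈ s <->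
     ((forall v, v ∈ g -> forall q, q ∈ d -> op (op u v) q ∈ h -> q ∈ c) /\
      forall c', c' ∈ c -> ~ forall v, v ∈ g -> forall q, q ∈ d -> op (op u v) q ∈ h -> q ∈ c')))
    by relsep.
  destruct hs as (s & Ms & _ & hs).
  destruct (rd g s gd Ms) as (c & cd & hc).
  - intros u q q' ug qd q'd i i'. apply hs in i, i'; auto. destruct i as [i1 i2], i' as [j1 j2].
    destruct (ord_compare q q') as [l | [l | l]]; auto.
    + eapply ord_in; eauto.
    + eapply ord_in; eauto.
    + destruct (j2 q l i1).
    + destruct (i2 q' l j1).
  - destruct (sur c cd) as (u & ug & v & vg & i).
    destruct (bd u ug) as (c1 & c1d & h1).
    destruct (least_mem (fun c => c ∈ d /\ forall v, v ∈ g -> forall q, q ∈ d -> op (op u v) q ∈ h -> q ∈ c) c1)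
      as (c2 & (c2d & h2) & h3); auto.
    assert (c2c : c2 ∈ c).
    { apply (hc u c2); auto. apply hs; auto. split; auto. intros c' l k. apply (h3 c' l). split; auto.
      eapply ord_trans; eauto. }
    exact (mem_asym _ _ c2c (h2 v vg c cd i)).
Qed.

Lemma pairing_in :
  (exists g, M g /\ forall a b y, a ∈ d -> b ∈ d -> y ∈ d -> (op (op a b) y ∈ g <-> paired d a b y)) /\
  (forall a b, a ∈ d -> b ∈ d -> exists y, y ∈ d /\ paired d a b y) /\
  (forall a b y y', a ∈ d -> b ∈ d -> y ∈ d -> y' ∈ d -> paired d a b y -> paired d a b y' -> y = y') /\
  (forall a b a' b' y, a ∈ d -> b ∈ d -> a' ∈ d -> b' ∈ d -> y ∈ d ->
     paired d a b y -> paired d a' b' y -> a = a' /\ b = b') /\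
  (forall g, g ∈ d -> exists c, c ∈ d /\
     forall a b y, a ∈ g -> b ∈ g -> y ∈ d -> paired d a b y -> y ∈ c).
Proof.
  assert (I : forall x, x ∈ d -> M x) by (intros; eapply trans_in; eauto).
  assert (td : forall y z, y ∈ d -> z ∈ y -> z ∈ d) by exact (proj1 od).
  destruct (product_in M d d mM Md Md) as (X & MX & hX).
  assert (iX : forall a b, a ∈ d -> b ∈ d -> op a b ∈ X) by (intros; apply hX; eauto 6).
  assert (eg : forall a b y, paired d a b y <-> collapses X d (gless d) (op a b) y).
  { intros a b y; split.
    - intro h; apply h; exact hX.
    - intros h X' hX'. replace X' with X; auto. apply mem_ext; intro z. rewrite (hX z), (hX' z). tauto. }
  assert (h : exists r, M r /\ is_rel r X X /\ forall x' x, x' ∈ X -> x ∈ X -> (op x' x ∈ r <-> gless d x' x)).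
  { unfold gless, is_max; relsep. }
  destruct h as (r & Mr & _ & hr).
  assert (ind : forall P : U -> Prop,
     (forall x, x ∈ X -> (forall x', x' ∈ X -> gless d x' x -> P x') -> P x) -> forall x, x ∈ X -> P x).
  { intros P hP x xX. apply hX in xX. destruct xX as (a & ad & b & bd & ->). revert a b ad bd.
    apply lex_ind. intros a b ad bd IH. apply hP; auto.
    intros x' x'X l. apply hX in x'X. destruct x'X as (a' & a'd & b' & b'd & ->).
    apply IH; auto. apply gless_lex; auto. }
  assert (ext : forall x x', x ∈ X -> x' ∈ X -> (forall u, u ∈ X -> (gless d u x <-> gless d u x')) -> x = x').
  { intros x x' xX x'X h. apply hX in xX, x'X.
    destruct xX as (a & ad & b & bd & ->), x'X as (a' & a'd & b' & b'd & ->).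
    destruct (lex_total d a b a' b') as [l | [[-> ->] | l]]; auto; exfalso.
    - apply gless_lex in l; auto. apply h in l; auto. apply gless_lex in l; auto. exact (lex_irrefl _ _ l).
    - apply gless_lex in l; auto. apply h in l; auto. apply gless_lex in l; auto. exact (lex_irrefl _ _ l). }
  (* The graph is needed before totality: the closure condition of [collapse] is verified by means
     of it. *)
  destruct (bisim_in M X d r (gless d) (collapses X d (gless d))) as (k & Mk & _ & hk); auto.
  { intros; apply collapses_step; auto. }
  destruct (collapse M X d r (gless d)) as (_ & _ & _ & _ & tot); auto.
  { intros x p xX Mp pd hp. apply hX in xX. destruct xX as (a & ad & b & bd & ->).
    assert (oP : ord p).
    { split.
      - intros z w zp wz. assert (zd := pd z zp). assert (wd : w ∈ d) by eauto.
        apply hp in zp; auto. destruct zp as (x & xX & l & c).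
        apply collapses_step in c; auto. destruct c as [_ c]. destruct (c w wd wz) as (x' & x'X & l' & c').
        apply hp; auto. exists x'; split; auto. split; auto.
        apply hX in xX, x'X. destruct xX as (a1 & a1d & b1 & b1d & ->), x'X as (a2 & a2d & b2 & b2d & ->).
        apply gless_lex in l, l'; auto. apply gless_lex; auto. apply (lex_trans d a2 b2 a1 b1 a b); auto.
      - intros z zp. eapply od; eauto. }
    (* If the values below (a, b) exhausted [d], then [k] would map a part of g × g onto [d]. *)
    destruct (ord_subset p d) as [h | ->]; auto. exfalso.
    destruct (lex_bounded d a b) as (g & gd & hg); auto.
    assert (gs : forall u, u ∈ g -> u ∈ d) by eauto.
    apply (no_square_map g k gd Mk).
    - intros q qd. assert (q' := proj1 (hp q qd) qd). destruct q' as (x' & x'X & l & c).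
      assert (x'X' := x'X). apply hX in x'X. destruct x'X as (a' & a'd & b' & b'd & ->).
      assert (l' := l). apply gless_lex in l'; auto. destruct (hg a' b') as [a'g b'g]; auto.
      exists a'; split; auto. exists b'; split; auto. apply hk; auto.
    - intros u v q q' ug vg qd q'd i i'. apply hk in i, i'; auto.
      eapply collapses_unique with (x := op u v); eauto. }
  split; [|split; [|split; [|split]]].
  - exists k; split; auto. intros a b y ad bd yd. rewrite eg; auto.
  - intros a b ad bd. destruct (tot (op a b)) as (y & yd & c); auto. exists y; split; auto. apply eg; auto.
  - intros a b y y' ad bd yd y'd i i'. rewrite eg in i, i'. eapply collapses_unique with (x := op a b); eauto.
  - intros a b a' b' y ad bd a'd b'd yd i i'. rewrite eg in i, i'. apply (op_inj M); auto.
    eapply collapses_inj with (y := y); eauto.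
  (* The pair (g, g) lies above all of g × g, so its value bounds theirs. *)
  - intros g gd. destruct (tot (op g g)) as (c & cd & h); auto. exists c; split; auto.
    intros a b y ag bg yd i. rewrite eg in i. apply collapses_step in h; auto. destruct h as [h _].
    destruct (h (op a b)) as (y' & y'd & y'c & i'); eauto.
    + apply gless_lex; eauto. apply lex_square; auto.
    + replace y with y'; auto. eapply collapses_unique with (x := op a b); eauto.
Qed.

End PairingIn.

End Pairing.

(** * Dependent choice *)

Section DependentChoice.

Context {U : set_universe}.
Implicit Types (M : class U) (a b c d k x y z r s t u v w : U).

Definition is_fun s a S : Prop :=
  is_rel s a S /\ (forall x, x ∈ a -> exists y, y ∈ S /\ op x y ∈ s) /\
  (forall x y y', x ∈ a -> y ∈ S -> y' ∈ S -> op x y ∈ s -> op x y' ∈ s -> y = y').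

Lemma rel_in M s a S x y : zmodel M -> M s -> M a -> M S -> M x -> M y -> is_rel s a S -> op x y ∈ s ->
  x ∈ a /\ y ∈ S.
Proof.
  intros mM Ms Ma MS Mx My h i. destruct (h _ i) as (x' & x'a & y' & y'S & e).
  apply (op_inj M) in e; auto; [| eapply trans_in; eauto ..]. destruct e; subst; auto.
Qed.

Lemma function_to_abs M s a S : zmodel M -> M s -> M a -> M S ->
  (is_function_to M s a S <-> is_fun s a S).
Proof.
  intros mM Ms Ma MS.
  assert (Ia : forall x, x ∈ a -> M x) by (intros; eapply trans_in; eauto).
  assert (IS : forall x, x ∈ S -> M x) by (intros; eapply trans_in; eauto).
  split.
  - intros [(h1 & h2 & h3) h4]. split; [|split].
    + intros z zs. assert (Mz : M z) by (eapply trans_in; eauto).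
      destruct (h1 z Mz zs) as (x & Mx & y & My & xa & e). apply (opair_abs M) in e; auto. subst z.
      exists x; split; auto. exists y; split; auto. apply (h4 x Mx y My). apply related_abs; auto.
    + intros x xa. destruct (h2 x (Ia x xa) xa) as (y & My & e).
      exists y; split; [apply (h4 x (Ia x xa) y My e) | apply (related_abs M) in e; auto].
    + intros x y y' xa yS y'S i i'. apply (h3 x (Ia x xa) y (IS y yS) y' (IS y' y'S)); apply related_abs; auto.
  - intros (h1 & h2 & h3).
    assert (rel : forall x y, M x -> M y -> related M s x y -> x ∈ a /\ y ∈ S /\ op x y ∈ s).
    { intros x y Mx My i. apply (related_abs M) in i; auto. apply and_assoc; split; auto.
      apply (rel_in M s); auto. }
    split; [split; [|split]|].
    + intros p Mp ps. destruct (h1 p ps) as (x & xa & y & yS & ->).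
      exists x; split; auto. exists y; split; auto. split; auto. apply opair_abs; auto.
    + intros x Mx xa. destruct (h2 x xa) as (y & yS & i). exists y; split; auto. apply related_abs; auto.
    + intros x Mx y My y' My' i i'. apply rel in i, i'; auto. eapply h3 with (x := x); tauto.
    + intros x Mx y My i. apply rel in i; tauto.
Qed.

Lemma dependent_choice_abs M d S R : zmodel M -> M d -> ord d -> dependent_choice M d -> M S -> M R ->
  (exists y, y ∈ S) ->
  (forall s a, M s -> a ∈ d -> is_fun s a S -> exists y, y ∈ S /\ op s y ∈ R) ->
  exists f, M f /\ is_fun f d S /\ forall a, a ∈ d -> exists r y, M r /\ is_fun r a S /\
    (forall x y, x ∈ a -> y ∈ S -> (op x y ∈ r <-> op x y ∈ f)) /\ y ∈ S /\ op a y ∈ f /\ op r y ∈ R.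
Proof.
  intros mM Md od dc MS MR [y0 y0S] h.
  assert (Id : forall x, x ∈ d -> M x) by (intros; eapply trans_in; eauto).
  assert (IS : forall x, x ∈ S -> M x) by (intros; eapply trans_in; eauto).
  destruct (dc S MS R MR) as (f & Mf & hf & hd).
  - exists y0; auto.
  - intros s Ms (a & Ma & ad & hs). apply (function_to_abs M) in hs; auto.
    destruct (h s a Ms ad hs) as (y & yS & i). exists y; split; auto. split; auto. apply related_abs; auto.
  - apply (function_to_abs M) in hf; auto. exists f; split; auto. split; auto. intros a ad.
    destruct (hd a (Id a ad) ad) as (r & Mr & y & My & hr & i & j).
    apply (related_abs M) in i, j; auto.
    destruct (rel_in M f d S a y) as [_ yS]; auto; [apply hf|].
    assert (rf : forall x z, x ∈ a -> z ∈ S -> (op x z ∈ r <-> op x z ∈ f)).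
    { intros x z xa zS. assert (Mx : M x) by (eapply trans_in; eauto).
      rewrite (hr (op x z)) by (apply op_in; auto). split; [tauto |]. intro l; split; auto.
      exists x; split; auto. exists z; split; auto. split; auto. apply opair_abs; auto. apply op_in; auto. }
    exists r, y; repeat (split; auto).
    + intros p pr. assert (Mp : M p) by (eapply trans_in; eauto). apply hr in pr; auto.
      destruct pr as [pf (x & Mx & z & Mz & xa & e)]. apply (opair_abs M) in e; auto. subst p.
      exists x; split; auto. exists z; split; auto. eapply (rel_in M f d S x z); auto. apply hf.
    + intros x xa. assert (xd : x ∈ d) by (eapply ord_trans; eauto).
      destruct (proj1 (proj2 hf) x xd) as (z & zS & l). exists z; split; auto. apply rf; auto.
    + intros x z z' xa zS z'S l l'. apply rf in l, l'; auto. assert (xd : x ∈ d) by (eapply ord_trans; eauto).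
      eapply hf; eauto.
Qed.

(** Choice for families indexed by [d]: the history [s] enters [R] only through its domain [a], at
    which the next value has to satisfy [Q] if possible. *)
Lemma choice_in M d T Q : zmodel M -> M d -> ord d -> dependent_choice M d -> M T -> M Q ->
  exists f, M f /\ (forall a, a ∈ d -> (exists y, y ∈ T /\ op a y ∈ Q) -> exists y, y ∈ T /\ op a y ∈ f /\ op a y ∈ Q) /\
    (forall a y y', a ∈ d -> y ∈ T -> y' ∈ T -> op a y ∈ f -> op a y' ∈ f -> y = y').
Proof.
  intros mM Md od dc MT MQ.
  assert (Id : forall x, x ∈ d -> M x) by (intros; eapply trans_in; eauto).
  assert (IT : forall x, x ∈ T -> M x) by (intros; eapply trans_in; eauto).
  destruct (classic (exists y, y ∈ T)) as [[y0 y0T] | ne].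
  2:{ exists T; split; auto. split; [intros a _ [y [yT _]] | intros a y y' _ yT]; exfalso; eauto. }
  destruct (product_in M d T mM Md MT) as (X & MX & hX).
  destruct (power_in M X mM MX) as (P & MP & hP).
  (* [a] is the domain of [s], recovered as the set of arguments at which [s] has a value. *)
  assert (h : exists R, M R /\ is_rel R P T /\ forall s y, s ∈ P -> y ∈ T -> (op s y ∈ R <->
     forall a, a ∈ d -> (forall x, x ∈ d -> (x ∈ a <-> exists z, z ∈ T /\ op x z ∈ s)) ->
        (exists y', y' ∈ T /\ op a y' ∈ Q) -> op a y ∈ Q)) by relsep.
  destruct h as (R & MR & _ & hR).
  assert (sP : forall s a, M s -> a ∈ d -> is_fun s a T -> s ∈ P).
  { intros s a Ms ad [hs _]. apply hP; split; auto. intros p ps. apply hX.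
    destruct (hs p ps) as (x & xa & y & yT & ->). exists x; split; eauto. eapply ord_trans; eauto. }
  assert (dom : forall s a x, M s -> a ∈ d -> is_fun s a T -> x ∈ d -> (x ∈ a <-> exists z, z ∈ T /\ op x z ∈ s)).
  { intros s a x Ms ad hs xd. split; [apply hs|]. intros (z & zT & i).
    eapply (rel_in M s a T x z); auto. apply hs. }
  destruct (dependent_choice_abs M d T R) as (f & Mf & hf & hd); auto.
  - exists y0; auto.
  - intros s a Ms ad hs. assert (y : exists y, y ∈ T /\ ((exists y', y' ∈ T /\ op a y' ∈ Q) -> op a y ∈ Q)).
    (* [y0] is the default where [Q] offers nothing. *)
    { destruct (classic (exists y', y' ∈ T /\ op a y' ∈ Q)) as [[y hy] | n]; [exists y | exists y0]; tauto. }
    destruct y as (y & yT & i). exists y; split; auto. apply hR; eauto. intros a' a'd e.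
    replace a' with a; auto. apply mem_ext; intro x; split; intro l.
    + assert (xd : x ∈ d) by (eapply ord_trans; eauto). apply e; auto. apply (dom s a); auto.
    + assert (xd : x ∈ d) by (eapply ord_trans; eauto). apply (dom s a); auto. apply e; auto.
  - exists f; split; auto. split; [|apply hf]. intros a ad e.
    destruct (hd a ad) as (r & y & Mr & hr & _ & yT & i & j). exists y; split; auto; split; auto.
    rewrite hR in j by eauto. apply (j a ad); auto.
Qed.

End DependentChoice.

(** * The chain of small sets *)

Section Chain.

Context {U : set_universe}.
Implicit Types (a b c k x y z r s t u v w : U).

Definition pairing_graph (d g : U) : Prop :=
  forall a b y, a ∈ d -> b ∈ d -> y ∈ d -> (op (op a b) y ∈ g <-> paired d a b y).

Definition injective_pairing (d : U) : Prop :=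
  (forall a b, a ∈ d -> b ∈ d -> exists y, y ∈ d /\ paired d a b y) /\
  (forall a b y y', a ∈ d -> b ∈ d -> y ∈ d -> y' ∈ d -> paired d a b y -> paired d a b y' -> y = y') /\
  (forall a b a' b' y, a ∈ d -> b ∈ d -> a' ∈ d -> b' ∈ d -> y ∈ d ->
     paired d a b y -> paired d a' b' y -> a = a' /\ b = b').

(** An ordinal bound instead of a cardinality, so that smallness persists in larger models. *)
Definition small (M : class U) d x : Prop := exists b, b ∈ d /\ embeds M x b.

(** [Q] will be the power set of [T] in V or in V' ([covers_power]); the chain is built in W without
    referring to these models. *)
Definition covers (M : class U) d T Q : Prop :=
  (forall C z, C ∈ Q -> z ∈ C -> z ∈ T) /\
  forall A, M A -> (forall z, z ∈ A -> z ∈ T) -> small M d A ->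
    exists C, C ∈ Q /\ (forall z, z ∈ A -> z ∈ C) /\ small M d C.

Context (M : class U) (d T Q1 Q2 a0 g : U) (mM : zmodel M) (Md : M d) (od : ord d) (ld : limit d) (rd : regular_in M d).
Context (dc : dependent_choice M d) (MT : M T) (tT : trans T) (MQ1 : M Q1) (MQ2 : M Q2).
Context (Ma0 : M a0) (a0T : forall z, z ∈ a0 -> z ∈ T) (sa0 : small M d a0).
Context (cQ1 : covers M d T Q1) (cQ2 : covers M d T Q2).
Context (Mg : M g) (hg : pairing_graph d g) (pd : injective_pairing d).
Context (bounded : forall u, u ∈ d -> exists c, c ∈ d /\
     forall a b y, a ∈ u -> b ∈ u -> y ∈ d -> paired d a b y -> y ∈ c).

Let Id : forall x, x ∈ d -> M x.
Proof. intros; eapply trans_in; eauto. Qed.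
Let IT : forall x, x ∈ T -> M x.
Proof. intros; eapply trans_in; eauto. Qed.
Let td : forall x y, y ∈ d -> x ∈ y -> x ∈ d.
Proof. intros; eapply ord_trans; eauto. Qed.

Definition separates x y z : Prop := ~ (z ∈ x <-> z ∈ y).

Lemma separating_exists x y : x ∈ T -> y ∈ T -> x <> y -> exists z, z ∈ T /\ separates x y z.
Proof.
  intros xT yT ne. apply NNPP; intro n. apply ne, mem_ext. intro z. apply NNPP; intro k.
  apply n. exists z; split; auto. apply NNPP; intro l. apply k. split; intro m; exfalso; eauto.
Qed.

(** Pairs from [A] are indexed by pairing codes of elements of b × b, all below some c0 ∈ d, and one
    witness is chosen for each index. A diagonal pair (x, x) chooses [x] itself, which yields A ⊆
    D. *)
Lemma small_separating A : M A -> (forall z, z ∈ A -> z ∈ T) -> small M d A ->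
  exists D, M D /\ (forall z, z ∈ D -> z ∈ T) /\ small M d D /\ (forall z, z ∈ A -> z ∈ D) /\
    forall x y, x ∈ A -> y ∈ A -> x <> y -> exists z, z ∈ D /\ separates x y z.
Proof.
  intros MA AT (b & bd & f & Mf & tot & inj). assert (Mb := Id b bd).
  assert (tb : forall x, x ∈ b -> x ∈ d) by eauto.
  destruct pd as (pt & pf & pi). destruct (bounded b bd) as (c0 & c0d & hc0).
  assert (h : exists Q, M Q /\ is_rel Q d T /\ forall w z, w ∈ d -> z ∈ T -> (op w z ∈ Q <->
     exists x, x ∈ A /\ exists y, y ∈ A /\ exists u, u ∈ b /\ exists v, v ∈ b /\
      (op x u ∈ f /\ op y v ∈ f /\ op (op u v) w ∈ g /\
       ((x = y /\ z = x) \/ (~ x = y /\ ~ (z ∈ x <-> z ∈ y)))))) by relsep.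
  destruct h as (Q & MQ & _ & hQ).
  destruct (choice_in M d T Q) as (c & Mc & hc & cf); auto.
  assert (Mc0 := Id c0 c0d).
  assert (h : exists D, M D /\ forall z, z ∈ D <-> z ∈ T /\ exists w, w ∈ c0 /\ op w z ∈ c) by sep.
  destruct h as (D & MD & hD).
  assert (DT : forall z, z ∈ D -> z ∈ T) by (intro z; rewrite hD; tauto).
  assert (main : forall x y, x ∈ A -> y ∈ A -> exists z, z ∈ D /\
     ((x = y /\ z = x) \/ (~ x = y /\ separates x y z))).
  { intros x y xA yA. destruct (tot x xA) as (u & ub & xu), (tot y yA) as (v & vb & yv).
    destruct (pt u v) as (w & wd & hw); auto.
    assert (gw : op (op u v) w ∈ g) by (apply hg; auto).
    destruct (hc w wd) as (z & zT & z1 & z2).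
    { assert (e : exists z, z ∈ T /\ ((x = y /\ z = x) \/ (~ x = y /\ separates x y z))).
      { destruct (classic (x = y)) as [e | n]; [exists x; auto |].
        destruct (separating_exists x y) as (z & zT & hz); auto. exists z; auto. }
      destruct e as (z & zT & hz). exists z; split; auto. apply hQ; auto.
      exists x; split; auto. exists y; split; auto. exists u; split; auto. exists v; auto. }
    exists z; split.
    - apply hD; split; auto. exists w; split; auto. apply (hc0 u v); auto.
    - apply hQ in z2; auto. destruct z2 as (x' & x'A & y' & y'A & u' & u'b & v' & v'b & h1 & h2 & h3 & h4).
      apply hg in h3; auto. destruct (pi u v u' v' w); auto. subst u' v'.
      replace x with x' by eauto. replace y with y' by eauto. exact h4. }
  exists D; repeat split; auto.
  - exists c0; split; auto.
    (* The converse of the choice function embeds [D], as [embeds] does not ask for single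
       values. *)
    assert (h : exists e, M e /\ is_rel e D c0 /\ forall z w, z ∈ D -> w ∈ c0 -> (op z w ∈ e <-> op w z ∈ c))
      by relsep.
    destruct h as (e & Me & _ & he). exists e; split; auto. split.
    + intros z zD. assert (k := zD). apply hD in k. destruct k as (_ & w & wc & k).
      exists w; split; auto. apply he; auto.
    + intros z z' w zD z'D wc i i'. apply he in i, i'; auto. apply (cf w); eauto.
  - intros z zA. destruct (main z z zA zA) as (z' & z'D & [[_ ->] | [n _]]); auto. contradiction.
  - intros x y xA yA ne. destruct (main x y xA yA) as (z & zD & [[e _] | [_ k]]); eauto. contradiction.
Qed.

Definition ran h z : Prop := exists y, y ∈ d /\ op y z ∈ h.

(** An enumeration of a stage: a partial function into [T], with domain bounded in [d] and range
    containing [a0]. *)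
Definition is_code h : Prop :=
  (forall y, y ∈ d -> forall z, z ∈ T -> forall z', z' ∈ T -> op y z ∈ h -> op y z' ∈ h -> z = z') /\
  (exists k, k ∈ d /\ forall y, y ∈ d -> forall z, z ∈ T -> op y z ∈ h -> y ∈ k) /\
  (forall z, z ∈ a0 -> exists y, y ∈ d /\ op y z ∈ h).

Lemma code_exists A : M A -> (forall z, z ∈ A -> z ∈ T) -> (forall z, z ∈ a0 -> z ∈ A) -> small M d A ->
  exists h, M h /\ is_rel h d T /\ is_code h /\ forall z, z ∈ A -> ran h z.
Proof.
  intros MA AT aA (b & bd & f & Mf & tot & inj). assert (Mb := Id b bd).
  assert (h : exists h, M h /\ is_rel h d T /\ forall y z, y ∈ d -> z ∈ T -> (op y z ∈ h <->
     (y ∈ b /\ z ∈ A /\ op z y ∈ f))) by relsep.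
  destruct h as (h & Mh & rh & hh). exists h; split; auto; split; auto.
  assert (r : forall z, z ∈ A -> ran h z).
  { intros z zA. destruct (tot z zA) as (y & yb & i). exists y; split; eauto. apply hh; eauto. }
  split; auto. split; [|split].
  - intros y yd z zT z' z'T i i'. apply hh in i, i'; auto. apply (inj z z' y); tauto.
  - exists b; split; auto. intros y yd z zT i. apply hh in i; tauto.
  - intros z za. apply r; auto.
Qed.

Context (S : U) (MS : M S) (hS : forall h, h ∈ S <-> M h /\ is_rel h d T /\ is_code h).

Definition covered s z : Prop := exists x, x ∈ d /\ exists h, h ∈ S /\ (op x h ∈ s /\ exists y, y ∈ d /\ op y z ∈ h).

(** If [z] is entry [y] of the enumeration at [x], it is sent to the pairing code of (x, y). Such a
    code determines [z], though [z] may have several. *)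
Lemma cov_emb s A K : M s -> M A -> (forall z, z ∈ A -> z ∈ T) -> M K -> (forall x, x ∈ K -> x ∈ d) ->
  (forall x h h', x ∈ d -> h ∈ S -> h' ∈ S -> op x h ∈ s -> op x h' ∈ s -> h = h') ->
  (forall z, z ∈ A -> covered s z) ->
  (forall z x h y w, z ∈ A -> x ∈ d -> h ∈ S -> op x h ∈ s -> y ∈ d -> op y z ∈ h -> w ∈ d ->
     paired d x y w -> w ∈ K) ->
  embeds M A K.
Proof.
  intros Ms MA AT MK Kd fs cA bK. destruct pd as (pt & pf & pi).
  assert (h : exists f, M f /\ is_rel f A K /\ forall z w, z ∈ A -> w ∈ K -> (op z w ∈ f <->
     exists x, x ∈ d /\ exists h, h ∈ S /\ (op x h ∈ s /\ exists y, y ∈ d /\ (op y z ∈ h /\ op (op x y) w ∈ g))))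
    by relsep.
  destruct h as (f & Mf & _ & hf). exists f; split; auto. split.
  - intros z zA. destruct (cA z zA) as (x & xd & h & hS' & i & y & yd & j).
    destruct (pt x y xd yd) as (w & wd & k). assert (wK : w ∈ K) by eauto.
    exists w; split; auto. apply hf; auto. exists x; split; auto. exists h; split; auto. split; auto.
    exists y; split; auto. split; auto. apply hg; auto.
  - intros z z' w zA z'A wK i i'. apply hf in i, i'; auto.
    destruct i as (x & xd & h & h1 & i & y & yd & j & k), i' as (x' & x'd & h' & h1' & i' & y' & y'd & j' & k').
    apply hg in k, k'; auto. destruct (pi x y x' y' w); auto. subst x' y'.
    assert (h = h') by eauto. subst h'. apply hS in h1. destruct h1 as (_ & _ & fh & _).
    apply (fh y yd); auto.
Qed.

(** Regularity bounds the domains of the enumerations below [a] by one [c]. With m = max(a, c) only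
    pairs in m × m occur, and their codes are bounded in [d]. *)
Lemma cov_small s a A : M s -> a ∈ d -> is_fun s a S -> M A -> (forall z, z ∈ A <-> z ∈ T /\ covered s z) ->
  small M d A.
Proof.
  intros Ms ad fs MA hA. assert (Ma := Id a ad).
  assert (IS : forall h, h ∈ S -> M h) by (intros; eapply trans_in; eauto).
  assert (sa : forall x h, x ∈ d -> h ∈ S -> op x h ∈ s -> x ∈ a).
  { intros x h xd h1 i. eapply (rel_in M s a S x h); auto. apply fs. }
  (* The least bound makes [q] single-valued, as [regular_in] requires. *)
  assert (h : exists q, M q /\ is_rel q a d /\ forall x k, x ∈ a -> k ∈ d -> (op x k ∈ q <->
     exists h, h ∈ S /\ (op x h ∈ s /\ (forall y, y ∈ d -> forall z, z ∈ T -> op y z ∈ h -> y ∈ k) /\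
       forall k', k' ∈ k -> ~ forall y, y ∈ d -> forall z, z ∈ T -> op y z ∈ h -> y ∈ k'))) by relsep.
  destruct h as (q & Mq & _ & hq).
  destruct (rd a q ad Mq) as (c & cd & hc).
  { intros x k k' xa kd k'd i i'. apply hq in i, i'; auto.
    destruct i as (h & h1 & h2 & h3 & h4), i' as (h' & h1' & h2' & h3' & h4').
    assert (h = h') by (eapply fs; eauto). subst h'.
    destruct (ord_compare k k') as [l | [l | l]]; auto; [eapply ord_in; eauto .. | |].
    - destruct (h4' k l h3).
    - destruct (h4 k' l h3'). }
  destruct (ord_max a c d) as (m & md & am & cm); auto.
  destruct (bounded m md) as (K & Kd & hK).
  exists K; split; auto. apply (cov_emb s); auto.
  - intros z zA; apply hA in zA; tauto.
  - intros x xK; eauto.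
  - intros x h h' xd h1 h1' i i'. destruct fs as (_ & _ & fs). eapply fs with (x := x); eauto.
  - intros z zA; apply hA in zA; tauto.
  - intros z x h y w zA xd h1 i yd j wd k. apply (hK x y); auto.
    + apply (ord_le_trans x x m); [eapply ord_in; eauto | auto |].
      destruct am as [am | <-]; eauto. eapply ord_trans with (b := a); eauto. eapply ord_in; eauto.
    + assert (xa : x ∈ a) by eauto.
      assert (h2 := h1). apply hS in h2. destruct h2 as (_ & _ & _ & (k0 & k0d & hk0) & _).
      destruct (least_mem (fun k => k ∈ d /\ forall y, y ∈ d -> forall z, z ∈ T -> op y z ∈ h -> y ∈ k) k0)
        as (k1 & (k1d & hk1) & lk1); auto.
      assert (k1c : k1 ∈ c).
      { apply (hc x k1); auto. apply hq; auto. exists h; split; auto. split; auto. split; auto.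
        intros k' l n. apply (lk1 k' l); split; eauto. }
      assert (yk : y ∈ k1) by (apply (hk1 y yd z); auto; apply hA in zA; tauto).
      assert (om : ord m) by (eapply ord_in; eauto).
      assert (yc : y ∈ c) by (eapply ord_trans; [eapply ord_in; eauto | eauto | eauto]).
      destruct cm as [cm | <-]; auto. eapply ord_trans; eauto.
Qed.

(** The relation handed to dependent choice: the stage enumerated by [h] absorbs covers from [Q1]
    and [Q2] of all earlier stages, and elements separating their members. *)
Definition step_rel s h : Prop :=
  exists C, C ∈ Q1 /\ exists C', C' ∈ Q2 /\
    ((forall z, z ∈ T -> covered s z -> z ∈ C /\ z ∈ C') /\
     (forall z, z ∈ C -> exists y, y ∈ d /\ op y z ∈ h) /\
     (forall z, z ∈ C' -> exists y, y ∈ d /\ op y z ∈ h) /\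
     (forall x, x ∈ T -> forall y, y ∈ T -> covered s x -> covered s y -> ~ x = y ->
        exists z, z ∈ T /\ ((exists u, u ∈ d /\ op u z ∈ h) /\ ~ (z ∈ x <-> z ∈ y)))).

Lemma step_exists s a : M s -> a ∈ d -> is_fun s a S -> exists h, h ∈ S /\ step_rel s h.
Proof.
  intros Ms ad fs.
  assert (h : exists A, M A /\ forall z, z ∈ A <-> z ∈ T /\ covered s z) by (unfold covered; sep).
  destruct h as (A & MA & hA).
  assert (sA : small M d A) by (apply (cov_small s a); auto).
  assert (h : exists B, M B /\ (forall z, z ∈ B -> z ∈ T) /\ small M d B /\ (forall z, z ∈ a0 -> z ∈ B) /\
      forall z, z ∈ A -> z ∈ B).
  (* At the start the history is empty and [a0] is used; later the earlier stages already contain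
     it. *)
  { destruct (classic (exists x, x ∈ a)) as [[x xa] | n].
    - exists A; repeat split; auto; [intro z; rewrite hA; tauto |].
      intros z za. apply hA; split; auto. destruct fs as (_ & ft & _).
      destruct (ft x xa) as (h & h1 & i). exists x; split; eauto. exists h; split; auto. split; auto.
      apply hS in h1. apply h1; auto.
    - exists a0; repeat split; auto. intros z zA. apply hA in zA. exfalso.
      destruct zA as (_ & x & xd & h & h1 & i & _). apply n. exists x.
      eapply (rel_in M s a S x h); auto. eapply trans_in; eauto. apply fs. }
  destruct h as (B & MB & BT & sB & aB & AB).
  destruct (small_separating B) as (D & MD & DT & sD & BD & hD); auto.
  destruct cQ1 as [t1 c1], cQ2 as [t2 c2].
  (* Since D ⊆ C ⊆ C', one enumeration of [C'] meets all requirements. *)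
  destruct (c1 D) as (C & CQ & DC & sC); auto.
  destruct (c2 C) as (C' & CQ' & CC' & sC'); eauto.
  { eapply trans_in; eauto. }
  destruct (code_exists C') as (h & Mh & rh & ch & hh); eauto.
  { eapply trans_in; eauto. }
  exists h; split; [apply hS; auto |].
  exists C; split; auto. exists C'; split; auto. split; [|split; [|split]].
  - intros z zT zc. assert (z ∈ A) by (apply hA; auto). split; auto.
  - intros z zC. apply hh; auto.
  - intros z zC. apply hh; auto.
  - intros x xT y yT cx cy ne. destruct (hD x y) as (z & zD & sz); auto; try (apply AB, hA; auto).
    exists z; split; auto. split; auto. apply hh; auto.
Qed.

Lemma chain_aux : (exists y, y ∈ S) -> exists B, M B /\ (forall z, z ∈ B -> z ∈ T) /\ (forall z, z ∈ a0 -> z ∈ B) /\ embeds M B d /\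
  (forall x y, x ∈ B -> y ∈ B -> x <> y -> exists z, z ∈ B /\ separates x y z) /\
  forall A, M A -> (forall z, z ∈ A -> z ∈ B) -> small M d A ->
    (exists C, C ∈ Q1 /\ (forall z, z ∈ A -> z ∈ C) /\ (forall z, z ∈ C -> z ∈ B)) /\
    (exists C, C ∈ Q2 /\ (forall z, z ∈ A -> z ∈ C) /\ (forall z, z ∈ C -> z ∈ B)).
Proof.
  intro neS.
  assert (IS : forall h, h ∈ S -> M h) by (intros; eapply trans_in; eauto).
  destruct (product_in M d S mM Md MS) as (X & MX & hX).
  destruct (power_in M X mM MX) as (P & MP & hP).
  assert (h : exists R, M R /\ is_rel R P S /\ forall s h, s ∈ P -> h ∈ S -> (op s h ∈ R <-> step_rel s h)).
  { unfold step_rel, covered; relsep. }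
  destruct h as (R & MR & _ & hR).
  assert (sP : forall s a, M s -> a ∈ d -> is_fun s a S -> s ∈ P).
  { intros s a Ms ad [hs _]. apply hP; split; auto. intros p ps. apply hX.
    destruct (hs p ps) as (x & xa & y & yT & ->). exists x; split; eauto. }
  destruct (dependent_choice_abs M d S R) as (f & Mf & ff & hf); auto.
  { intros s a Ms ad fs. destruct (step_exists s a) as (h & h1 & h2); auto.
    exists h; split; auto. apply hR; eauto. }
  assert (h : exists B, M B /\ forall z, z ∈ B <-> z ∈ T /\ covered f z) by (unfold covered; sep).
  destruct h as (B & MB & hB).
  assert (nxt : forall a, a ∈ d -> exists r h, h ∈ S /\ op a h ∈ f /\ step_rel r h /\
     forall x h z, x ∈ a -> h ∈ S -> op x h ∈ f -> ran h z -> covered r z).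
  { intros a ad. destruct (hf a ad) as (r & h & Mr & fr & rf & h1 & h2 & h3).
    exists r, h; split; auto; split; auto. apply hR in h3; eauto. split; auto.
    intros x h' z xa h1' i (y & yd & j). exists x; split; eauto. exists h'; split; auto.
    split; [apply rf; auto | eauto]. }
  assert (inB : forall a h z, a ∈ d -> h ∈ S -> op a h ∈ f -> z ∈ T -> ran h z -> z ∈ B).
  { intros a h z ad h1 i zT rz. apply hB; split; auto. exists a; split; auto. exists h; auto. }
  assert (BT : forall z, z ∈ B -> z ∈ T) by (intro z; rewrite hB; tauto).
  exists B; split; auto; split; auto. split; [|split; [|split]].
  - intros z za. destruct (proj1 ld) as [a ad]. destruct ff as (_ & ft & _).
    destruct (ft a ad) as (h & h1 & i). apply (inB a h); auto. apply hS in h1. apply h1; auto.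
  - apply (cov_emb f); auto.
    + intros x h h'. apply ff.
    + intros z zB; apply hB in zB; tauto.
  - intros x y xB yB ne. assert (xT := BT x xB). assert (yT := BT y yB).
    apply hB in xB, yB. destruct xB as (_ & a & ad & h & h1 & i & rx), yB as (_ & b & bd & h' & h1' & i' & ry).
    destruct (ord_max a b d) as (m & md & am & bm); auto.
    (* Both [x] and [y] occur at stages before [n], so the stage at [n] separates them. *)
    destruct (proj2 ld m md) as (n & nd & hn).
    destruct (nxt n nd) as (r & h2 & h3 & h4 & (C & _ & C' & _ & _ & _ & _ & sp) & cr).
    destruct (sp x xT y yT) as (z & zT & rz & hz); auto.
    + apply (cr a h); auto. apply hn; auto.
    + apply (cr b h'); auto. apply hn; auto.
    + exists z; split; auto. apply (inB n h2); auto.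
  - intros A MA AB (b & bd & e & Me & et & ei). assert (Mb := Id b bd).
    (* [q] sends the code of an element of [A] to the first stage containing that element. By
       regularity these stages are bounded by some [c], and the covers used at stage [c] contain
       [A]. *)
    assert (h : exists q, M q /\ is_rel q b d /\ forall y a, y ∈ b -> a ∈ d -> (op y a ∈ q <->
      exists x, x ∈ A /\ (op x y ∈ e /\ (exists h, h ∈ S /\ (op a h ∈ f /\ exists u, u ∈ d /\ op u x ∈ h)) /\
       forall a', a' ∈ a -> ~ exists h, h ∈ S /\ (op a' h ∈ f /\ exists u, u ∈ d /\ op u x ∈ h)))) by relsep.
    destruct h as (q & Mq & _ & hq).
    destruct (rd b q bd Mq) as (c & cd & hc).
    { intros y a a' yb ad a'd i i'. apply hq in i, i'; auto.
      destruct i as (x & xA & i1 & i2 & i3), i' as (x' & x'A & i1' & i2' & i3').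
      assert (x = x') by eauto. subst x'.
      destruct (ord_compare a a') as [l | [l | l]]; auto; [eapply ord_in; eauto .. | |].
      - destruct (i3' a l i2).
      - destruct (i3 a' l i2'). }
    destruct (nxt c cd) as (r & h & h1 & i & (C & CQ & C' & CQ' & cC & hC & hC' & _) & cr).
    assert (AC : forall z, z ∈ A -> z ∈ C /\ z ∈ C').
    { intros z zA. apply cC; auto.
      assert (zB := AB z zA). apply hB in zB. destruct zB as (_ & a & ad & hz).
      destruct (least_mem (fun a => a ∈ d /\ exists h, h ∈ S /\ (op a h ∈ f /\ exists u, u ∈ d /\ op u z ∈ h)) a)
        as (a1 & (a1d & h' & h1' & i' & rz) & la); auto.
      destruct (et z zA) as (y & yb & j).
      apply (cr a1 h'); auto. apply (hc y); auto. apply hq; auto. exists z; split; auto. split; auto.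
      split; [exists h'; auto |]. intros a' l n. apply (la a' l); split; eauto. }
    split; [exists C | exists C']; (split; [auto | split; [intros z zA; apply AC; auto |]]); intros z zC;
      apply (inB c h); auto.
    + destruct cQ1; eauto.
    + apply hC; auto.
    + destruct cQ2; eauto.
    + apply hC'; auto.
Qed.

End Chain.

(** * Approximation and transfer *)

Section Transfer.

Context {U : set_universe}.
Implicit Types (M V W : class U) (a b c d k x y z r s t u v w : U).

Lemma chain M d T Q1 Q2 a0 : zmodel M -> M d -> ord d -> limit d -> regular_in M d -> dependent_choice M d ->
  M T -> trans T -> M Q1 -> M Q2 -> M a0 -> (forall z, z ∈ a0 -> z ∈ T) -> small M d a0 ->
  covers M d T Q1 -> covers M d T Q2 ->
  exists B, M B /\ (forall z, z ∈ B -> z ∈ T) /\ (forall z, z ∈ a0 -> z ∈ B) /\ embeds M B d /\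
  (forall x y, x ∈ B -> y ∈ B -> x <> y -> exists z, z ∈ B /\ separates x y z) /\
  forall A, M A -> (forall z, z ∈ A -> z ∈ B) -> small M d A ->
    (exists C, C ∈ Q1 /\ (forall z, z ∈ A -> z ∈ C) /\ (forall z, z ∈ C -> z ∈ B)) /\
    (exists C, C ∈ Q2 /\ (forall z, z ∈ A -> z ∈ C) /\ (forall z, z ∈ C -> z ∈ B)).
Proof.
  intros mM Md od ld rd dc MT tT MQ1 MQ2 Ma0 a0T sa0 c1 c2.
  destruct (pairing_in M d mM Md od ld rd) as ((g & Mg & hg) & p1 & p2 & p3 & p4).
  destruct (product_in M d T mM Md MT) as (X & MX & hX).
  destruct (power_in M X mM MX) as (P & MP & hP).
  (* Codes are subsets of d × T, so they form a set. *)
  assert (h : exists S, M S /\ forall h, h ∈ S <-> h ∈ P /\ is_code d T a0 h) by (unfold is_code; sep).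
  destruct h as (S & MS & hS).
  assert (hS' : forall h, h ∈ S <-> M h /\ is_rel h d T /\ is_code d T a0 h).
  { intro h. rewrite hS, hP. unfold is_rel. split.
    - intros [[Mh k] c]. split; auto. split; auto. intros z zh. apply hX; auto.
    - intros (Mh & k & c). split; auto. split; auto. intros z zh. apply hX; auto. }
  destruct (code_exists M d T a0 mM Md od MT a0 Ma0) as (h & h1 & h2 & h3 & _); auto.
  apply (chain_aux M d T Q1 Q2 a0 g) with (S := S); auto.
  - split; [|split]; auto.
  - exists h. apply hS'; auto.
Qed.

Lemma inter_in M a b : zmodel M -> M a -> M b -> exists c, M c /\ forall z, z ∈ c <-> z ∈ a /\ z ∈ b.
Proof. intros mM Ma Mb. sep. Qed.

Lemma small_sub M N d a b : subclass M N -> (forall x, x ∈ b -> x ∈ a) -> small M d a -> small N d b.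
Proof. intros MN ba (k & kd & e). exists k; split; auto. eapply emb_sub; eauto. Qed.

Lemma size_lt_small M d a : zmodel M -> M a -> size_lt M a d -> small M d a.
Proof. intros mM Ma (b & Mb & (_ & e & _) & h). exists b; split; auto. apply equinumerous_emb; auto. Qed.

Lemma small_size_lt M d a : zmodel M -> M d -> ord d -> M a -> small M d a -> size_lt M a d.
Proof.
  intros mM Md od Ma (b & bd & e). assert (Mb : M b) by (eapply trans_in; eauto).
  destruct (emb_cardinality M a b) as (c & Mc & cb & h); auto; [eapply ord_in; eauto|].
  exists c; split; auto; split; auto. eapply ord_le_trans; eauto.
Qed.

Lemma covers_power V W d T Q : zmodel V -> zmodel W -> subclass V W -> V d -> ord d ->
  cover_property V W d -> V T -> (forall z, z ∈ Q <-> V z /\ forall w, w ∈ z -> w ∈ T) ->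
  covers W d T Q.
Proof.
  intros mV mW VW Vd od cv VT hQ. split.
  { intros C z CQ zC. apply hQ in CQ. apply CQ; auto. }
  intros A WA AT sA. destruct (cv A WA) as (B & VB & AB & sB).
  - intros z zA. apply (trans_in V z T); auto.
  - apply small_size_lt; auto.
  - apply size_lt_small in sB; auto.
    destruct (inter_in V B T mV VB VT) as (C & VC & hC).
    exists C; split; [apply hQ; split; auto; intro z; rewrite hC; tauto | split].
    + intros z zA; apply hC; auto.
    + apply (small_sub V W d B); auto. intro z; rewrite hC; tauto.
Qed.

(** For small [a] in V, a set [C] in V with B ∩ a ⊆ C ⊆ B satisfies C ∩ a = B ∩ a. *)
Lemma approximated_in V W d B : zmodel V -> zmodel W -> subclass V W -> V d -> W B ->
  approximation_property V W d -> (forall z, z ∈ B -> V z) ->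
  (forall A, W A -> (forall z, z ∈ A -> z ∈ B) -> small W d A ->
     exists C, V C /\ (forall z, z ∈ A -> z ∈ C) /\ (forall z, z ∈ C -> z ∈ B)) -> V B.
Proof.
  intros mV mW VW Vd WB ap BV h. apply ap; auto. intros a Va sa.
  apply size_lt_small in sa; auto. assert (Wa : W a) by auto.
  destruct (inter_in W B a mW WB Wa) as (A & WA & hA).
  destruct (h A WA) as (C & VC & AC & CB).
  - intro z; rewrite hA; tauto.
  - apply (small_sub V W d a); auto. intro z; rewrite hA; tauto.
  - destruct (inter_in V C a mV VC Va) as (c & Vc & hc). exists c; split; auto.
    intro z; rewrite hc. split; intros [i j]; split; auto. apply AC, hA; auto.
Qed.

(** Membership in V_b, by the recursion of the hierarchy carried out in the ambient logic and hence
    independent of models. *)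
Inductive rank_lt : U -> U -> Prop :=
| rank_lt_intro x b c : c ∈ b -> (forall y, y ∈ x -> rank_lt y c) -> rank_lt x b.

Lemma rank_lt_inv x b : rank_lt x b -> exists c, c ∈ b /\ forall y, y ∈ x -> rank_lt y c.
Proof. intros []; eauto. Qed.

Definition level M c v : Prop := M v /\ forall z, z ∈ v <-> M z /\ rank_lt z c.

Lemma rank_lt_mem x y b : ord b -> rank_lt x b -> y ∈ x -> rank_lt y b.
Proof.
  revert x y; induction b as [b IH] using (well_founded_ind (mem_wf U)). intros x y ob h yx.
  apply rank_lt_inv in h. destruct h as (c & cb & h). exists c; auto.
  intros z zy. apply (IH c cb y); auto. eapply ord_in; eauto.
Qed.

Lemma level_trans M c T : zmodel M -> ord c -> level M c T -> trans T.
Proof.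
  intros mM oc [MT hT] x y xT yx. apply hT. apply hT in xT. destruct xT as [Mx h]. split.
  - eapply trans_in; eauto.
  - eapply rank_lt_mem; eauto.
Qed.

Lemma size_le_emb M a d : zmodel M -> M a -> M d -> ord d -> size_le M a d -> embeds M a d.
Proof.
  intros mM Ma Md od (k & Mk & (_ & e & _) & h).
  apply equinumerous_emb in e; auto. destruct e as (f & Mf & tot & inj).
  assert (kd : forall x, x ∈ k -> x ∈ d) by (destruct h; subst; auto; intros; eapply ord_trans; eauto).
  assert (hf : exists f', M f' /\ is_rel f' a d /\ forall x y, x ∈ a -> y ∈ d -> (op x y ∈ f' <->
     (y ∈ k /\ op x y ∈ f))) by relsep.
  destruct hf as (f' & Mf' & _ & hf). exists f'; split; auto. split.
  - intros x xa. destruct (tot x xa) as (y & yk & i). exists y; split; auto. apply hf; auto.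
  - intros x x' y xa x'a yd i i'. apply hf in i, i'; auto. apply (inj x x' y); tauto.
Qed.

(** The transitive collapse of [B] is a transitive set in [V] of size at most [d] in [W]. *)
Lemma emb_reflects V W d T c B : zmodel V -> zmodel W -> subclass V W -> V d -> ord d -> ord c ->
  (forall x, hereditary_le W d x /\ V x <-> hereditary_le V d x) ->
  level V c T -> V B -> (forall z, z ∈ B -> z ∈ T) ->
  (forall x y, x ∈ B -> y ∈ B -> x <> y -> exists z, z ∈ B /\ separates x y z) ->
  embeds W B d -> embeds V B d.
Proof.
  intros mV mW VW Vd od oc sameH lT VB BT ext (e & We & et & ei).
  assert (tT := level_trans V c T mV oc lT). destruct lT as [VT hT].
  pose (E := fun x y : U => x ∈ y).
  assert (h : exists r, V r /\ is_rel r B B /\ forall x' x, x' ∈ B -> x ∈ B -> (op x' x ∈ r <-> x' ∈ x)) by relsep.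
  destruct h as (r & Vr & _ & hr).
  (* The collapse does not raise ranks, so its values stay in the level [T]; this gives the closure
     condition of [collapse]. *)
  assert (rk : forall q x a, x ∈ B -> q ∈ T -> collapses B T E x q -> rank_lt x a -> rank_lt q a).
  { intro q; induction q as [q IH] using (well_founded_ind (mem_wf U)). intros x a xB qT h hx.
    apply rank_lt_inv in hx. destruct hx as (b & ba & hx). exists b; auto. intros z zq.
    apply collapses_step in h; auto. destruct h as [_ h]. assert (zT : z ∈ T) by (eapply tT; eauto).
    destruct (h z zT zq) as (x' & x'B & x'x & i). apply (IH z zq x'); auto. }
  destruct (collapse V B T r E) as (k & Vk & _ & hk & tk); auto.
  { intros P hP x. induction x as [x IH] using (well_founded_ind (mem_wf U)). intro xB. apply hP; auto. }
  { intros x p xB Vp pT hp. apply hT; split; auto.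
    assert (xT := BT x xB). apply hT in xT. destruct xT as [_ hx].
    apply rank_lt_inv in hx. destruct hx as (b & bc & hx). exists b; auto. intros q qp.
    assert (qT := pT q qp). apply hp in qp; auto. destruct qp as (x' & x'B & x'x & i).
    apply (rk q x'); auto. }
  assert (h : exists N, V N /\ forall q, q ∈ N <-> q ∈ T /\ exists x, x ∈ B /\ op x q ∈ k) by sep.
  destruct h as (N & VN & hN).
  assert (NT : forall q, q ∈ N -> q ∈ T) by (intro q; rewrite hN; tauto).
  assert (tN : trans N).
  { intros q z qN zq. assert (zT : z ∈ T) by (eapply tT; eauto). apply hN; split; auto.
    apply hN in qN. destruct qN as (qT & x & xB & i). apply hk in i; auto. apply collapses_step in i; auto.
    destruct i as [_ i]. destruct (i z zT zq) as (x' & x'B & _ & j). exists x'; split; auto. apply hk; auto. }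
  assert (Wd := VW d Vd). assert (WN := VW N VN). assert (WB := VW B VB). assert (Wk := VW k Vk).
  assert (eN : embeds W N d).
  { assert (h : exists f, W f /\ is_rel f N d /\ forall q y, q ∈ N -> y ∈ d -> (op q y ∈ f <->
      exists x, x ∈ B /\ (op x q ∈ k /\ op x y ∈ e))) by relsep.
    destruct h as (f & Wf & _ & hf). exists f; split; auto. split.
    - intros q qN. assert (h := qN). apply hN in h. destruct h as (qT & x & xB & i).
      destruct (et x xB) as (y & yd & j). exists y; split; auto. apply hf; eauto.
    - intros q q' y qN q'N yd i i'. apply hf in i, i'; auto.
      destruct i as (x & xB & i1 & i2), i' as (x' & x'B & i1' & i2').
      assert (x = x') by eauto. subst x'. apply hk in i1, i1'; auto.
      apply (collapses_unique B T E tT q x q'); auto. }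
  (* The hypothesis on H enters here; [N], being transitive, is its own transitive closure in W. *)
  assert (hN' : hereditary_le V d N).
  { apply sameH. split; auto. split; auto. exists N; split; auto. split.
    - split; [|split].
      + intros x Wx xN z Wz zx. apply (tN x); auto.
      + intros x Wx; auto.
      + intros s Ws _ h; exact h.
    - apply emb_size_le; auto. }
  destruct hN' as (_ & t & Vt & (_ & Nt & _) & st).
  apply size_le_emb in st; auto.
  apply (emb_sub V V t N) in st; [| intros x; auto | intros x xN; apply Nt; auto; eapply trans_in; eauto].
  destruct st as (f & Vf & ft & fi).
  assert (h : exists f', V f' /\ is_rel f' B d /\ forall x y, x ∈ B -> y ∈ d -> (op x y ∈ f' <->
      exists q, q ∈ N /\ (op x q ∈ k /\ op q y ∈ f))) by relsep.
  destruct h as (f' & Vf' & _ & hf'). exists f'; split; auto. split.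
  - intros x xB. destruct (tk x xB) as (q & qT & i).
    assert (qN : q ∈ N) by (apply hN; split; auto; exists x; split; auto; apply hk; auto).
    destruct (ft q qN) as (y & yd & j). exists y; split; auto. apply hf'; auto.
    exists q; split; auto. split; auto. apply hk; auto.
  - intros x x' y xB x'B yd i i'. apply hf' in i, i'; auto.
    destruct i as (q & qN & i1 & i2), i' as (q' & q'N & i1' & i2').
    assert (q = q') by eauto. subst q'. apply hk in i1, i1'; auto.
    apply (collapses_inj B T E) with (y := q); auto.
    (* The separating elements in [B] make (B, ∈) extensional, hence the collapse injective. *)
    intros u v uB vB h. apply NNPP; intro n. destruct (ext u v uB vB n) as (z & zB & hz). apply hz, h; auto.
Qed.

(** Via the pairing function, the isomorphism type of [(B, ∈)] is coded by a subset of [d]. *)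
Lemma emb_transfer V V' d B : zmodel V -> zmodel V' -> V d -> V' d -> ord d -> limit d ->
  regular_in V d -> regular_in V' d -> (forall x, V x -> (forall z, z ∈ x -> z ∈ d) -> V' x) -> V B -> V' B ->
  (forall x y, x ∈ B -> y ∈ B -> x <> y -> exists z, z ∈ B /\ separates x y z) ->
  embeds V B d -> embeds V' B d /\ forall X, V X -> (forall z, z ∈ X -> z ∈ B) -> V' X.
Proof.
  intros mV mV' Vd V'd od ld rV rV' pw VB V'B ext (e & Ve & et & ei).
  destruct (pairing_in V d mV Vd od ld rV) as ((g & Vg & hg) & p1 & p2 & p3 & _).
  destruct (pairing_in V' d mV' V'd od ld rV') as ((g' & V'g' & hg') & _).
  (* [D] is the set of all codes of elements of [B], and [C] below codes the membership relation
     between them. *)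
  assert (h : exists D, V D /\ forall y, y ∈ D <-> y ∈ d /\ exists x, x ∈ B /\ op x y ∈ e) by sep.
  destruct h as (D & VD & hD).
  assert (h : exists C, V C /\ forall w, w ∈ C <-> w ∈ d /\ exists y', y' ∈ d /\ exists y, y ∈ d /\
     (op (op y' y) w ∈ g /\ exists x', x' ∈ B /\ exists x, x ∈ B /\ (x' ∈ x /\ op x' y' ∈ e /\ op x y ∈ e))) by sep.
  destruct h as (C & VC & hC).
  assert (Dd : forall z, z ∈ D -> z ∈ d) by (intro; rewrite hD; tauto).
  assert (V'D : V' D) by (apply pw; auto).
  assert (V'C : V' C) by (apply pw; auto; intro; rewrite hC; tauto).
  pose (E := fun y' y => exists x', x' ∈ B /\ exists x, x ∈ B /\ (x' ∈ x /\ op x' y' ∈ e /\ op x y ∈ e)).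
  assert (h : exists r, V' r /\ is_rel r D D /\ forall y' y, y' ∈ D -> y ∈ D -> (op y' y ∈ r <->
     exists w, w ∈ C /\ op (op y' y) w ∈ g')) by relsep.
  destruct h as (r & V'r & _ & hr).
  (* Read backwards, [e] maps (D, E) onto (B, ∈) as a collapse does. It satisfies the recursion of
     [step], so [bisim_in] finds it in V', although only V is known to contain [e]. *)
  destruct (bisim_in V' D B r E (fun y x => op x y ∈ e)) as (k & V'k & _ & hk); auto.
  { intros y y' yD y'D. rewrite hr; auto. split.
    - intros (w & wC & i). apply hC in wC. destruct wC as (wd & z' & z'd & z & zd & j & h).
      apply hg in j; auto. apply hg' in i; auto. destruct (p3 y' y z' z w); auto. subst. exact h.
    - intro h. destruct (p1 y' y) as (w & wd & i); auto. exists w; split.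
      + apply hC; split; auto. exists y'; split; auto. exists y; split; auto. split; auto. apply hg; auto.
      + apply hg'; auto. }
  { intros y x yD xB. split.
    - intro i. split.
      + intros y' y'D (x' & x'B & x1 & x1B & h1 & h2 & h3). assert (x1 = x) by eauto. subst x1. eauto.
      + intros x' x'B x'x. destruct (et x' x'B) as (y' & y'd & j). exists y'; split; [apply hD; eauto |].
        split; auto. exists x'; split; auto. exists x; auto.
    (* [x0] is the element coded by [y]; it and [x] have the same elements in [B]. *)
    - intros [h1 h2]. assert (h := yD). apply hD in h. destruct h as (yd & x0 & x0B & i).
      replace x with x0; auto. apply NNPP; intro n.
      destruct (ext x0 x x0B xB n) as (z & zB & hz). apply hz; split; intro l.
      + destruct (et z zB) as (y' & y'd & j). destruct (h1 y') as (z' & z'B & z'x & j').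
        * apply hD; eauto.
        * exists z; split; auto. exists x0; auto.
        * replace z with z'; eauto.
      + destruct (h2 z zB l) as (y' & y'D & (x' & x'B & x1 & x1B & i1 & i2 & i3) & j).
        assert (x1 = x0) by eauto. assert (x' = z) by eauto. subst; auto. }
  split.
  - assert (h : exists f, V' f /\ is_rel f B d /\ forall x y, x ∈ B -> y ∈ d -> (op x y ∈ f <->
      (y ∈ D /\ op y x ∈ k))) by relsep.
    destruct h as (f & V'f & _ & hf). exists f; split; auto. split.
    + intros x xB. destruct (et x xB) as (y & yd & i). exists y; split; auto. apply hf; auto.
      assert (yD : y ∈ D) by (apply hD; eauto). split; auto. apply hk; auto.
    + intros x x' y xB x'B yd i i'. apply hf in i, i'; auto. destruct i as [yD i], i' as [_ i'].
      apply hk in i, i'; auto. eauto.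
  - intros X VX XB.
    (* [X] is turned into its set of codes, a subset of [d], which V' decodes by [k]. *)
    assert (h : exists Y, V Y /\ forall y, y ∈ Y <-> y ∈ D /\ exists x, x ∈ X /\ op x y ∈ e) by sep.
    destruct h as (Y & VY & hY).
    assert (V'Y : V' Y) by (apply pw; auto; intros z h; apply hY in h; apply Dd; tauto).
    assert (h : exists Z, V' Z /\ forall x, x ∈ Z <-> x ∈ B /\ exists y, y ∈ Y /\ op y x ∈ k) by sep.
    destruct h as (Z & V'Z & hZ). replace X with Z; auto.
    apply mem_ext; intro x; rewrite hZ; split.
    + intros (xB & y & yY & i). apply hY in yY. destruct yY as (yD & x' & x'X & j).
      apply hk in i; auto. replace x with x'; auto. apply (ei x' x y); auto.
    + intro xX. split; auto. destruct (et x (XB x xX)) as (y & yd & i).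
      assert (yD : y ∈ D) by (apply hD; eauto). exists y; split; [apply hY; eauto | apply hk; auto].
Qed.

End Transfer.

(** * The cumulative hierarchy *)

Section Levels.

Context {U : set_universe}.
Implicit Types (M V W : class U) (a b c d k x y z r s t u v w : U).

Lemma hierarchy_levels M s f : zmodel M -> M s -> ord s -> M f -> is_hierarchy M f s ->
  forall b, b ∈ s -> exists v, level M b v /\ related M f b v.
Proof.
  intros mM Ms os Mf ((_ & tot & fn) & rec) b.
  induction b as [b IH] using (well_founded_ind (mem_wf U)). intro bs.
  assert (Mb : M b) by (apply (trans_in M b s); auto).
  destruct (tot b Mb bs) as (v & Mv & hv). exists v; split; auto. split; auto.
  assert (IH' : forall c, c ∈ b -> exists u, M c /\ level M c u /\ related M f c u).
  { intros c cb. assert (cs : c ∈ s) by (eapply ord_trans; eauto).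
    destruct (IH c cb cs) as (u & h). exists u; split; auto. apply (trans_in M c s); auto. }
  intro z; split.
  - intro zv. assert (Mz : M z) by (apply (trans_in M z v); auto). split; auto.
    destruct (proj1 (rec b Mb v Mv hv z Mz) zv) as (c & Mc & cb & u & Mu & i & zu).
    destruct (IH' c cb) as (u' & _ & [Mu' l] & j).
    assert (u = u') by (apply (fn c Mc u Mu u' Mu'); auto). subst u'.
    exists c; auto. intros y yz. apply l, zu; auto. apply (trans_in M y z); auto.
  - intros [Mz h]. apply (rec b Mb v Mv hv z Mz). apply rank_lt_inv in h. destruct h as (c & cb & h).
    destruct (IH' c cb) as (u & Mc & [Mu l] & j).
    exists c; split; auto. split; auto. exists u; split; auto. split; auto.
    intros y My yz. apply l; auto.
Qed.

Lemma rank_exists M x : zmodel M -> M x -> exists a, M a /\ ord a /\ rank_lt x a /\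
  forall b, b ∈ a -> exists v, level M b v.
Proof.
  intros mM Mx. destruct (mM) as [_ (_ & _ & _ & _ & _ & _ & _ & hh)].
  destruct (hh x Mx) as (a & Ma & v & Mv & (oa & s & Ms & hs & f & Mf & hf & i) & xv).
  apply (is_ordinal_abs M) in oa; auto.
  assert (hs' : forall z, z ∈ s <-> z ∈ a \/ z = a).
  { intro z; split; intro h.
    - apply hs; auto. apply (trans_in M z s); auto.
    - apply hs; auto. destruct h; subst; auto. apply (trans_in M z a); auto. }
  assert (os : ord s) by (eapply ord_succ; [exact oa | auto]).
  assert (l := hierarchy_levels M s f mM Ms os Mf hf).
  exists a; split; auto. split; auto. split.
  - destruct (l a) as (v' & [Mv' l'] & j); [apply hs'; auto |].
    destruct hf as [(_ & _ & fn) _]. assert (v = v') by (apply (fn a Ma v Mv v' Mv'); auto). subst v'. apply l'; auto.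
  - intros b ba. destruct (l b) as (u & h & _); [apply hs'; auto |]. eauto.
Qed.

Lemma rank_lt_ord a b : ord a -> ord b -> rank_lt a b -> a ∈ b.
Proof.
  revert a; induction b as [b IH] using (well_founded_ind (mem_wf U)). intros a oa ob h.
  apply rank_lt_inv in h. destruct h as (c & cb & h). apply (ord_le_trans a c b); auto.
  assert (oc : ord c) by (eapply ord_in; eauto).
  apply ord_subset; auto. intros z za. apply IH; auto. eapply ord_in; eauto.
Qed.

(** The hierarchy axiom, applied to [b] itself, yields an ordinal a with b ∈ V_a, so b ∈ a; the
    levels below a all exist. *)
Lemma level_exists M b : zmodel M -> M b -> ord b -> exists v, level M b v.
Proof.
  intros mM Mb ob. destruct (rank_exists M b mM Mb) as (a & Ma & oa & h & l).
  apply l, rank_lt_ord; auto.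
Qed.

(** Let [a] be least outside V. An ordinal of V not in [a] would be at least [a] and put [a] into V.
    So for [s] in V, a ∩ s is the set of ordinals in [s], which V has by separation. *)
Lemma ordinals_in V W d a : zmodel V -> zmodel W -> subclass V W -> approximation_property V W d ->
  W a -> ord a -> V a.
Proof.
  intros mV mW VW ap. induction a as [a IH] using (well_founded_ind (mem_wf U)). intros Wa oa.
  apply NNPP; intro n.
  assert (aV : forall z, z ∈ a -> V z).
  { intros z za. apply IH; auto; [apply (trans_in W z a) | eapply ord_in]; eauto. }
  apply n, ap; auto. intros s Vs _.
  assert (h : exists c, V c /\ forall x, x ∈ c <-> x ∈ s /\
    ((forall y, y ∈ x -> forall z, z ∈ y -> z ∈ x) /\
     (forall y, y ∈ x -> forall z, z ∈ y -> forall w, w ∈ z -> w ∈ y))) by sep.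
  destruct h as (c & Vc & hc). exists c; split; auto. intro z; rewrite hc. split.
  - intros (zs & h1 & h2). split; auto.
    assert (oz : ord z).
    { split; [intros y t yz ty; exact (h1 y yz t ty) | intros y yz t w ty wt; exact (h2 y yz t ty w wt)]. }
    assert (Vz : V z) by (apply (trans_in V z s); auto).
    destruct (ord_compare z a) as [h | [h | h]]; auto; exfalso; apply n.
    + subst; auto.
    + apply (trans_in V a z); auto.
  - intros [za zs]. split; auto. assert (oz : ord z) by (apply (ord_in a); auto). split.
    + intros y yz t ty; exact (proj1 oz y t yz ty).
    + intros y yz t ty w wt; exact (proj2 oz y yz t w ty wt).
Qed.

End Levels.

(** * Equality of the two models *)

Section Main.

Context {U : set_universe}.
Implicit Types (a b c d k x y z r s t u v w T : U).

Context (V V' W : class U) (d : U).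
Context (mV : zmodel V) (mV' : zmodel V') (mW : zmodel W) (Vd : V d) (V'd : V' d).
Context (dc : dependent_choice W d) (od : ord d) (ld : limit d) (rW : regular_in W d).
Context (VW : subclass V W) (V'W : subclass V' W).
Context (coverV : cover_property V W d) (approxV : approximation_property V W d).
Context (coverV' : cover_property V' W d) (approxV' : approximation_property V' W d).
Context (samePower : forall x, V x -> (forall z, z ∈ x -> z ∈ d) -> V' x).
Context (samePower' : forall x, V' x -> (forall z, z ∈ x -> z ∈ d) -> V x).
Context (sameH : forall x, hereditary_le W d x /\ V x <-> hereditary_le V d x).

Lemma common_cover c T a0 : ord c -> level V c T -> V' T -> W a0 -> (forall z, z ∈ a0 -> z ∈ T) -> small W d a0 ->
  exists B, V B /\ V' B /\ (forall z, z ∈ a0 -> z ∈ B) /\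
    forall X, (forall z, z ∈ X -> z ∈ B) -> (V X <-> V' X).
Proof.
  intros oc lT V'T Wa0 a0T sa0. assert (tT := level_trans V c T mV oc lT).
  assert (VT : V T) by exact (proj1 lT).
  destruct (power_in V T mV VT) as (Q & VQ & hQ). destruct (power_in V' T mV' V'T) as (Q' & V'Q' & hQ').
  destruct (chain W d T Q Q' a0) as (B & WB & BT & aB & eB & ext & cl); auto.
  { apply (covers_power V); auto. }
  { apply (covers_power V'); auto. }
  assert (VB : V B).
  { apply (approximated_in V W d); auto.
    - intros z zB. apply (trans_in V z T); auto.
    - intros A WA AB sA. destruct (cl A WA AB sA) as [(C & CQ & h) _]. exists C; split; auto. apply hQ; auto. }
  assert (V'B : V' B).
  { apply (approximated_in V' W d); auto.
    - intros z zB. apply (trans_in V' z T); auto.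
    - intros A WA AB sA. destruct (cl A WA AB sA) as [_ (C & CQ & h)]. exists C; split; auto. apply hQ'; auto. }
  assert (rV := regular_in_sub V W d VW rW).
  assert (rV' := regular_in_sub V' W d V'W rW).
  assert (eV : embeds V B d) by (apply (emb_reflects V W d T c); auto).
  (* The first transfer also provides the embedding in V' from which the reverse transfer starts. *)
  destruct (emb_transfer V V' d B) as [eV' t]; auto.
  destruct (emb_transfer V' V d B) as [_ t']; auto.
  exists B; repeat split; auto.
Qed.

Lemma same_subsets c T A : ord c -> level V c T -> V' T -> (forall z, z ∈ A -> z ∈ T) -> (V A <-> V' A).
Proof.
  intros oc lT V'T AT. assert (VT : V T) by exact (proj1 lT).
  assert (main : forall N N' : class U, zmodel N -> zmodel N' -> subclass N W -> subclass N' W -> N T -> N' T ->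
    approximation_property N' W d ->
    (forall a0, W a0 -> (forall z, z ∈ a0 -> z ∈ T) -> small W d a0 ->
      exists B, N B /\ N' B /\ (forall z, z ∈ a0 -> z ∈ B) /\
        forall X, (forall z, z ∈ X -> z ∈ B) -> N X -> N' X) -> N A -> N' A).
  { intros N N' mN mN' NW N'W NT N'T ap cc NA. apply ap; auto.
    { intros z zA. apply (trans_in N' z T); auto. }
    intros a N'a sa. apply size_lt_small in sa; auto.
    destruct (inter_in N' a T mN' N'a N'T) as (a0 & N'a0 & ha0).
    destruct (cc a0) as (B & NB & N'B & aB & h); auto.
    { intro z; rewrite ha0; tauto. }
    { apply (small_sub N' W d a); auto. intro z; rewrite ha0; tauto. }
    (* A ∩ B passes from [N] to [N']; as a ∩ T ⊆ B, intersecting it with [a] gives A ∩ a. *)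
    destruct (inter_in N A B mN NA NB) as (X & NX & hX).
    assert (N'X : N' X) by (apply h; auto; intro z; rewrite hX; tauto).
    destruct (inter_in N' X a mN' N'X N'a) as (Y & N'Y & hY). exists Y; split; auto.
    intro z; rewrite hY, hX. split; [tauto |]. intros [zA za]. repeat split; auto. apply aB, ha0; auto. }
  split.
  - apply (main V V'); auto. intros a0 Wa0 a0T sa0.
    destruct (common_cover c T a0) as (B & h1 & h2 & h3 & h4); auto. exists B; repeat split; auto.
    intros X hX; apply h4; auto.
  - apply (main V' V); auto. intros a0 Wa0 a0T sa0.
    destruct (common_cover c T a0) as (B & h1 & h2 & h3 & h4); auto. exists B; repeat split; auto.
    intros X hX; apply h4; auto.
Qed.

Lemma same_levels b v v' : ord b -> V b -> V' b -> level V b v -> level V' b v' -> v = v'.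
Proof.
  revert v v'; induction b as [b IH] using (well_founded_ind (mem_wf U)).
  intros v v' ob Vb V'b [Vv l] [V'v' l'].
  (* If [z] is in one of the models, it is a subset of a level at some c ∈ b, which is common to
     both by induction, so [same_subsets] applies. *)
  assert (h : forall z, rank_lt z b -> (V z <-> V' z)).
  { intros z h. apply rank_lt_inv in h. destruct h as (c & cb & h).
    assert (Vc : V c) by (apply (trans_in V c b); auto).
    assert (V'c : V' c) by (apply (trans_in V' c b); auto).
    assert (oc : ord c) by (eapply ord_in; eauto).
    destruct (level_exists V c) as (T & hT); auto. destruct (level_exists V' c) as (T' & hT'); auto.
    assert (T = T') by (eapply IH; eauto). subst T'.
    assert (ss := same_subsets c T z oc hT (proj1 hT')).
    split; intro Nz; apply ss; auto; intros y yz.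
    - apply hT; split; auto. apply (trans_in V y z); auto.
    - apply hT'; split; auto. apply (trans_in V' y z); auto. }
  apply mem_ext; intro z. rewrite l, l'. split; intros [i j]; split; auto; apply h; auto.
Qed.

Lemma models_equal x : V x <-> V' x.
Proof.
  (* The two models have the same ordinals, since each has all those of W. *)
  assert (I : forall a, ord a -> V a -> V' a).
  { intros a oa Va. apply (ordinals_in V' W d); auto. }
  assert (I' : forall a, ord a -> V' a -> V a).
  { intros a oa Va. apply (ordinals_in V W d); auto. }
  assert (h : forall a, ord a -> V a -> V' a -> rank_lt x a -> (V x <-> V' x)).
  { intros a oa Va V'a h.
    destruct (level_exists V a) as (v & lv); auto. destruct (level_exists V' a) as (v' & lv'); auto.
    assert (v = v') by (eapply same_levels; eauto). subst v'.
    split; intro Nx.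
    - apply (trans_in V' x v); [auto | apply lv; auto | exact (proj1 lv')].
    - apply (trans_in V x v); [auto | apply lv'; auto | exact (proj1 lv)]. }
  split; intro Nx.
  - destruct (rank_exists V x) as (a & Va & oa & r & _); auto. apply (h a); auto.
  - destruct (rank_exists V' x) as (a & Va & oa & r & _); auto. apply (h a); auto.
Qed.

End Main.

Theorem theorem3p2 (U : set_universe) (V V' W : class U) (δ : U)
  (modelV : transitive_model V δ)
  (modelV' : transitive_model V' δ)
  (modelW : transitive_model W δ)
  (regδ : regular_cardinal W δ)
  (subV : subclass V W)
  (subV' : subclass V' W)
  (coverV : cover_property V W δ)
  (approxV : approximation_property V W δ)
  (coverV' : cover_property V' W δ)
  (approxV' : approximation_property V' W δ)
  (samePower : forall x : U, power_class V δ x <-> power_class V' δ x)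
  (sameH : forall x : U, hereditary_le W δ x /\ V x <-> hereditary_le V δ x) :
  forall x : U, V x <-> V' x.
Proof.
  destruct modelV as (tV & Vd & zV & _), modelV' as (tV' & V'd & zV' & _), modelW as (tW & Wd & zW & dc).
  assert (mW : zmodel W) by (split; auto).
  destruct (regular_cardinal_regular_in W δ mW regδ) as (od & ld & rW).
  apply (models_equal V V' W δ); auto.
  - split; auto.
  - split; auto.
  - intros x Vx h. apply samePower; split; [auto | intros z _; auto].
  - intros x Vx h. apply samePower; split; [auto | intros z _; auto].
Qed.
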